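(* Let $\bar{\mathbb{N}}=\mathbb{N}\cup\{\infty\}$ be the one-point compactification of the discrete space $\mathbb{N}$, and fix a universal randomness test $\mathbf{t}$ over $\bar{\mathbb{N}}$. There is no neutral probability measure $\nu$ over $\bar{\mathbb{N}}$ (i.e. with $\mathbf{t}_\nu(x)\le1$ for all $x\in\bar{\mathbb{N}}$) that is upper semicomputable over $\mathbb{N}$ or lower semicomputable over $\mathbb{N}$.
   Context: $\bar{\mathbb{N}}$ is a compact computable metric space (e.g. identify $n$ with $1/(n+1)$ and $\infty$ with $0$ in the real line). Probability measures on it carry the weak topology and the Prokhorov-metric computability structure. A randomness test is a lower semicomputable $(\mu,x)\mapsto f_\mu(x)\in[0,\infty]$ with $\int f_\mu d\mu\le1$ for all probability measures $\mu$; a universal test $\mathbf{t}$ dominates every test up to a positive multiplicative constant. A measure $\nu$ is upper (lower) semicomputable over $\mathbb{N}$ if the function $n\mapsto\nu(\{n\})$, $n\in\mathbb{N}$, is upper (lower) semicomputable, i.e. $\{(n,r)\in\mathbb{N}\times\mathbb{Q}:\nu(\{n\})<r\}$ (resp. $>r$) is recursively enumerable. *)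

(* Defs.v *)
From HB Require Import structures.
From mathcomp Require Import all_boot all_order all_algebra.
From mathcomp Require Import all_classical all_reals all_analysis.
Set Implicit Arguments.
Unset Strict Implicit.
Unset Printing Implicit Defensive.
Import Order.TTheory GRing.Theory Num.Theory.

Local Open Scope classical_set_scope.

(** * Partial recursive functions and recursively enumerable sets *)

Inductive recfun : nat -> Type :=
| Zero k : recfun k
| Succ : recfun 1
| Proj k : 'I_k -> recfun k
| Comp k m : recfun m -> ('I_m -> recfun k) -> recfun k
| Prec k : recfun k -> recfun k.+2 -> recfun k.+1
| Mu k : recfun k.+1 -> recfun k.

(** [reval c v y]: the partial function [c] is defined at [v], with value [y].
    In [Prec] the recursion variable comes first, and [s] lists the successive
    values of the recursion; in [Mu] the searched variable comes first. *)
Fixpoint reval k (c : recfun k) : k.-tuple nat -> nat -> Prop :=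
  match c in recfun k return k.-tuple nat -> nat -> Prop with
  | Zero _ => fun _ y => y = 0
  | Succ => fun v y => y = (thead v).+1
  | Proj _ i => fun v y => y = tnth v i
  | Comp _ m f g => fun v y => exists w : m.-tuple nat,
      (forall i, reval (g i) v (tnth w i)) /\ reval f w y
  | Prec k f g => fun v y => exists s : nat -> nat,
      [/\ reval f [tuple of behead v] (s 0),
          forall i, i < thead v ->
            reval g [tuple of i :: s i :: behead v] (s i.+1) &
          y = s (thead v)]
  | Mu _ f => fun v y => reval f [tuple of y :: v] 0 /\
      forall i, i < y -> exists z, reval f [tuple of i :: v] z.+1
  end.

Definition rec_enum k (A : set (k.-tuple nat)) : Prop :=
  exists c : recfun k, forall v, A v <-> exists y, reval c v y.

(** Numbering of the rationals: [n] codes a finite sequence [a; b; c; ...]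
    (padded with zeros) and stands for [(a - b) / (c + 1)]. *)
Definition ratnum (n : nat) : rat :=
  let s := CodeSeq.decode n in
  ((nth 0%N s 0)%:R - (nth 0%N s 1)%:R)%R / ((nth 0%N s 2).+1)%:R.

(** * The space [nat U {oo}] *)

(** [Some n] is the natural number [n], and [None] is the point at infinity;
    the measurable sets are the Borel sets. *)
Definition Nbar := g_sigma_algebraType (@open (one_point_compactification nat)).

(** [n] is identified with [1/(n+1)], and infinity with [0]. *)
Definition Nbar_real (R : realType) (x : Nbar) : R :=
  (if x is Some n then n.+1%:R^-1 else 0)%R.

Definition Nbar_dist (R : realType) (x y : Nbar) : R :=
  `|Nbar_real R x - Nbar_real R y|%R.

Definition Nbar_point (j : nat) : Nbar :=
  if j is n.+1 then Some n else None.

(** * Probability measures *)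

(** Basic measures: if [i] codes the sequence [w_0; ...; w_l], the point number
    [j] has weight [w_j / (w_0 + ... + w_l)]. If all [w_j] are zero, the measure
    is the Dirac measure at infinity. These are exactly the finitely supported
    probability measures with rational weights. *)
Definition basic_measure (R : realType) (i : nat) : probability Nbar R :=
  let w := CodeSeq.decode i in
  mnormalize
    (msum (fun j => mscale ((nth 0%N w j)%:R%:nng)%R (dirac (Nbar_point j)))
          (size w))
    (dirac (None : Nbar)).

Definition thickening (R : realType) (A : set Nbar) (e : R) : set Nbar :=
  [set x | exists2 y, A y & (Nbar_dist R x y < e)%R].

Definition prokhorov (R : realType) (mu nu : probability Nbar R) : R :=
  inf [set e : R | (0 < e)%R /\ forall A : set Nbar, measurable A ->
    (mu A <= nu (thickening A e) + e%:E)%E].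

(** * Randomness tests *)

(** The sets [{(mu, x) | f mu x > r}], [r] rational, are unions, recursively
    enumerable uniformly in [r], of products of basic balls. In
    [[tuple i; p; j; q; r]], [i] and [j] number the centers, and [p], [q], [r]
    number rationals. *)
Definition lower_semicomputable (R : realType)
    (f : probability Nbar R -> Nbar -> \bar R) : Prop :=
  exists2 W : set (5.-tuple nat), rec_enum W &
    forall (mu : probability Nbar R) (x : Nbar) (r : nat),
      ((ratr (ratnum r))%:E < f mu x)%E <->
      exists i p j q : nat,
        [/\ W [tuple i; p; j; q; r],
            (prokhorov mu (basic_measure R i) < ratr (ratnum p))%R &
            (Nbar_dist R x (Nbar_point j) < ratr (ratnum q))%R].

Definition randomness_test (R : realType)
    (f : probability Nbar R -> Nbar -> \bar R) : Prop :=
  [/\ forall mu x, (0 <= f mu x)%E,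
      lower_semicomputable f &
      forall mu : probability Nbar R, (\int[mu]_x f mu x <= 1)%E].

Definition universal_test (R : realType)
    (t : probability Nbar R -> Nbar -> \bar R) : Prop :=
  randomness_test t /\
  forall f, randomness_test f ->
    exists2 c : R, (0 < c)%R & forall mu x, (c%:E * f mu x <= t mu x)%E.

Definition neutral (R : realType) (t : probability Nbar R -> Nbar -> \bar R)
    (nu : probability Nbar R) : Prop :=
  forall x, (t nu x <= 1)%E.

Definition upper_semicomputable_over_nat (R : realType)
    (nu : probability Nbar R) : Prop :=
  rec_enum [set v : 2.-tuple nat | exists n r : nat,
    v = [tuple n; r] /\
    (nu [set (Some n : Nbar)] < (ratr (ratnum r))%:E)%E].

Definition lower_semicomputable_over_nat (R : realType)
    (nu : probability Nbar R) : Prop :=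
  rec_enum [set v : 2.-tuple nat | exists n r : nat,
    v = [tuple n; r] /\
    ((ratr (ratnum r))%:E < nu [set (Some n : Nbar)])%E].

(* Main.v *)
(** If nu is neutral for a universal test, every test is bounded at nu.  A test that
    gives value 2^l to natural numbers of mass below d^-1, where d is much larger
    than 2^l, is legitimate as soon as few numbers are selected at each level l
    for each measure; it is a contradiction to select, for arbitrarily large l,
    a number that is light for nu.

    Upper semicomputable nu: select the first number seen to be light.

    Lower semicomputable nu: a number s found late enough that the approximation
    of nu from below has gained almost all its mass should be light.  The measure
    itself, known to some precision on [0, M), tells when the approximation has
    settled on [0, M); two adjacent intervals of precision are possible for a
    measure, so at most two numbers are selected.  If the approximation had settled
    on [0, M) at stage s while s still carries noticeable mass, then the total mass
    would cross a point i / g of a fixed grid after stage s.  But a second test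
    selects, at the stage of each crossing, a number below M that looks light;
    as the approximation has settled, that number is light, and the second test
    forbids this. *)
Require Import Defs.
From HB Require Import structures.
From mathcomp Require Import all_boot all_order all_algebra.
From mathcomp Require Import all_classical all_reals all_analysis.
From mathcomp Require Import zify ring lra.
Set Implicit Arguments.
Unset Strict Implicit.
Unset Printing Implicit Defensive.
Import Order.TTheory GRing.Theory Num.Theory.
Local Open Scope classical_set_scope.

(** * Computable functions and recursively enumerable sets *)

(** Arguments are lists, so that they can be built with [::] and [behead] without dependent lengths;
    only the values at lists of length [k] matter. *)
Definition computable k (F : seq nat -> nat) :=
  exists c : recfun k, forall (v : k.-tuple nat) y, reval c v y <-> y = F v.

Definition computable_map k m (G : seq nat -> seq nat) :=
  (forall v, size v = k -> size (G v) = m) /\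
  forall i, i < m -> computable k (fun v => nth 0 (G v) i).

Lemma eq_computable k F F' :
  (forall v, size v = k -> F v = F' v) -> computable k F -> computable k F'.
Proof.
by move=> FF' [c cP]; exists c => v y; rewrite -FF' ?size_tuple.
Qed.

Lemma computable_comp k m F G :
  computable m F -> computable_map k m G -> computable k (fun v => F (G v)).
Proof.
move=> [c cP] [Gs Gc].
have /choice[g gP] : forall i : 'I_m, exists g : recfun k,
    forall (v : k.-tuple nat) y, reval g v y <-> y = nth 0 (G v) i.
  by move=> i; exact: Gc.
exists (Comp c g) => v y /=; split=> [[w [gw /cP ->]]|->].
  congr F; apply: (@eq_from_nth _ 0); first by rewrite size_tuple Gs ?size_tuple.
  move=> i; rewrite size_tuple => im; have /gP := gw (Ordinal im).
  by rewrite (tnth_nth 0).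
have Gv : size (G v) == m by rewrite Gs ?size_tuple.
by exists (Tuple Gv); split=> [i|]; [apply/gP; rewrite (tnth_nth 0)|apply/cP].
Qed.

Lemma computable_id_map k : computable_map k k id.
Proof.
split=> // i ik; exists (Proj (Ordinal ik)) => v y /=.
by rewrite (tnth_nth 0).
Qed.

Lemma computable_behead_map k m G :
  computable_map k m.+1 G -> computable_map k m (fun v => behead (G v)).
Proof.
move=> [Gs Gc]; split=> [v vk|i im]; first by rewrite size_behead Gs.
by apply: eq_computable (Gc i.+1 im) => v _; rewrite nth_behead.
Qed.

Lemma computable_nil_map k : computable_map k 0 (fun=> [::]).
Proof. by []. Qed.

Lemma computable_cons_map k m F G : computable k F -> computable_map k m G ->
  computable_map k m.+1 (fun v => F v :: G v).
Proof.
by move=> Fc [Gs Gc]; split=> [v vk /=|[|i] im //=]; [rewrite Gs|exact: Gc].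
Qed.

Lemma computable_nth k m G i : computable_map k m G -> i < m ->
  computable k (fun v => nth 0 (G v) i).
Proof. by move=> [_ Gc] /Gc. Qed.

(** [Prec] recurses on its first argument and keeps the others as parameters. The counter is
    therefore prepended as a new argument, and [n v :: v] is substituted afterwards. *)
Lemma computable_rec k n F H : computable k n -> computable k F ->
  computable k.+2 (fun w => H (behead (behead w)) (nth 0 w 0) (nth 0 w 1)) ->
  computable k (fun v => nat_rect _ (F v) (H v) (n v)).
Proof.
move=> nc [cf fP] [ch hP].
suff rc : computable k.+1
    (fun w => nat_rect _ (F (behead w)) (H (behead w)) (nth 0 w 0)).
  apply: (computable_comp rc (G := fun v => n v :: v)).
  exact/computable_cons_map/computable_id_map.
exists (Prec cf ch) => v y /=; case/tupleP: v => n0 v.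
have -> : thead [tuple of n0 :: v] = n0 by [].
have -> : [tuple of behead [tuple of n0 :: v]] = v by exact/val_inj.
have step i x r : reval ch [tuple of i :: x :: behead (n0 :: v)] r <->
    r = H v i x.
  rewrite (_ : [tuple of _] = [tuple of i :: x :: v]); last exact/val_inj.
  by rewrite hP.
split=> [[s [/fP s0 sS ->]]|->] /=.
  have : n0 <= n0 by [].
  elim: {-2}n0 => [|i IH] i0 //=; rewrite -IH; last exact: ltnW.
  by apply/step; exact: sS.
exists (fun i => nat_rect _ (F v) (H v) i); split=> //; first exact/fP.
by move=> i _; exact/step.
Qed.

(** * Arithmetic operations, boolean connectives and bounded quantification *)

Lemma computable0 k : computable k (fun=> 0).
Proof. by exists (Zero k). Qed.

Lemma computableS k F : computable k F -> computable k (fun v => (F v).+1).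
Proof.
move=> Fc; apply: (@computable_comp _ 1 (fun w => (nth 0 w 0).+1) (fun v => [:: F v])).
  by exists Succ => v y /=; rewrite /thead (tnth_nth 0).
exact/computable_cons_map/computable_nil_map.
Qed.

Lemma computable_cst k n : computable k (fun=> n).
Proof. by elim: n => [|n]; [exact: computable0|exact: computableS]. Qed.

Ltac computable_var :=
  cbv beta; lazymatch goal with
  | |- computable_map _ _ (fun v => behead (@?G v)) =>
      refine (@computable_behead_map _ _ G _); computable_var
  | |- computable_map _ _ (fun v => v) => exact: computable_id_map
  | |- computable_map _ _ id => exact: computable_id_map
  | |- computable _ (fun v => nth 0 (@?G v) _) =>
      refine (@computable_nth _ _ G _ _ _); [computable_var|by []]
  end.

Lemma computable_addn k F G : computable k F -> computable k G ->
  computable k (fun v => F v + G v).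
Proof.
move=> Fc Gc; apply: (@eq_computable _ (fun v => nat_rect _ (F v) (fun _ => S) (G v))).
  by move=> v _; elim: (G v) => [|n /= ->]; rewrite ?addn0 ?addnS.
by apply: computable_rec => //; apply: computableS; computable_var.
Qed.

Lemma computable_muln k F G : computable k F -> computable k G ->
  computable k (fun v => F v * G v).
Proof.
move=> Fc Gc; apply: (@eq_computable _ (fun v => nat_rect _ 0 (fun _ r => r + F v) (G v))).
  by move=> v _; elim: (G v) => [|n /= ->]; rewrite ?muln0 // mulnS addnC.
apply: computable_rec => //; first exact: computable0.
apply: computable_addn; first by computable_var.
by apply: computable_comp Fc _; computable_var.
Qed.

Lemma computable_expn k F G : computable k F -> computable k G ->
  computable k (fun v => F v ^ G v).
Proof.
move=> Fc Gc; apply: (@eq_computable _ (fun v => nat_rect _ 1 (fun _ r => r * F v) (G v))).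
  by move=> v _; elim: (G v) => [|n /= ->]; rewrite ?expn0 // expnSr.
apply: computable_rec => //; first exact: computable_cst.
apply: computable_muln; first by computable_var.
by apply: computable_comp Fc _; computable_var.
Qed.

Lemma computable_predn k F : computable k F -> computable k (fun v => (F v).-1).
Proof.
move=> Fc; apply: (@eq_computable _ (fun v => nat_rect _ 0 (fun i _ => i) (F v))).
  by move=> v _; case: (F v).
by apply: computable_rec => //; [exact: computable0|computable_var].
Qed.

Lemma computable_subn k F G : computable k F -> computable k G ->
  computable k (fun v => F v - G v).
Proof.
move=> Fc Gc; apply: (@eq_computable _ (fun v => nat_rect _ (F v) (fun _ => predn) (G v))).
  by move=> v _; elim: (G v) => [|n /= ->]; rewrite ?subn0 // subnS.
by apply: computable_rec => //; apply: computable_predn; computable_var.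
Qed.

Lemma computable_negb k P : computable k (fun v => nat_of_bool (P v)) ->
  computable k (fun v => nat_of_bool (~~ P v)).
Proof.
move=> Pc; apply: (@eq_computable _ (fun v => 1 - P v)).
  by move=> v _; case: (P v).
exact/computable_subn/Pc/computable_cst.
Qed.

Lemma computable_leq k F G : computable k F -> computable k G ->
  computable k (fun v => nat_of_bool (F v <= G v)).
Proof.
move=> Fc Gc; apply: (@eq_computable _ (fun v => 1 - (F v - G v))).
  by move=> v _; rewrite /leq; case: (F v - G v) => [|[]].
apply: computable_subn; first exact: computable_cst.
exact: computable_subn.
Qed.

Lemma computable_andb k P Q : computable k (fun v => nat_of_bool (P v)) ->
  computable k (fun v => nat_of_bool (Q v)) ->
  computable k (fun v => nat_of_bool (P v && Q v)).
Proof.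
move=> Pc Qc; apply: (@eq_computable _ (fun v => P v * Q v)).
  by move=> v _; rewrite mulnb.
exact: computable_muln.
Qed.

Lemma computable_orb k P Q : computable k (fun v => nat_of_bool (P v)) ->
  computable k (fun v => nat_of_bool (Q v)) ->
  computable k (fun v => nat_of_bool (P v || Q v)).
Proof.
move=> Pc Qc; apply: (@eq_computable _ (fun v => ~~ (~~ P v && ~~ Q v))).
  by move=> v _; rewrite negb_and !negbK.
by apply: computable_negb; apply: computable_andb; exact: computable_negb.
Qed.

Lemma computable_eqn k F G : computable k F -> computable k G ->
  computable k (fun v => nat_of_bool (F v == G v)).
Proof.
move=> Fc Gc; apply: (@eq_computable _ (fun v => (F v <= G v) && (G v <= F v))).
  by move=> v _; rewrite eqn_leq.
by apply: computable_andb; exact: computable_leq.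
Qed.

Lemma computable_if k P F G : computable k (fun v => nat_of_bool (P v)) ->
  computable k F -> computable k G ->
  computable k (fun v => if P v then F v else G v).
Proof.
move=> Pc Fc Gc; apply: (@eq_computable _ (fun v => P v * F v + ~~ P v * G v)).
  by move=> v _; case: (P v); rewrite ?mul1n ?mul0n ?addn0.
apply: computable_addn; apply: computable_muln => //; exact: computable_negb.
Qed.

Lemma computable_sum k n H : computable k n ->
  computable k.+1 (fun w => H (behead w) (nth 0 w 0)) ->
  computable k (fun v => \sum_(i < n v) H v i).
Proof.
move=> nc Hc.
apply: (@eq_computable _ (fun v => nat_rect _ 0 (fun i r => r + H v i) (n v))).
  by move=> v _; elim: (n v) => [|m IH /=]; rewrite ?big_ord0 // big_ord_recr /= IH.
apply: computable_rec => //; first exact: computable0.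
apply: computable_addn; first by computable_var.
apply: (computable_comp Hc (G := fun w => nth 0 w 0 :: behead (behead w))).
by apply: computable_cons_map; computable_var.
Qed.

Fixpoint bex n (P : nat -> bool) := if n is m.+1 then bex m P || P m else false.

Lemma bexP n (P : nat -> bool) : reflect (exists2 i, i < n & P i) (bex n P).
Proof.
elim: n => [|n IH] /=; first by constructor; case.
apply: (iffP orP) => [[/IH[i /leqW lt_in Pi]|Pn]|[i]].
- by exists i.
- by exists n.
- rewrite ltnS leq_eqVlt => /predU1P[->|lt_in] Pi; first by right.
  by left; apply/IH; exists i.
Qed.

Lemma computable_bex k n P : computable k n ->
  computable k.+1 (fun w => nat_of_bool (P (behead w) (nth 0 w 0))) ->
  computable k (fun v => nat_of_bool (bex (n v) (P v))).
Proof.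
move=> nc Pc.
apply: (@eq_computable _ (fun v => 0 < \sum_(i < n v) P v i)).
  move=> v _; elim: (n v) => [|m IH /=]; rewrite ?big_ord0 // big_ord_recr /=.
  by rewrite addn_gt0 (can_inj oddb IH); case: (P v m); case: bex.
apply: computable_leq; first exact: computable_cst.
exact: (computable_sum (H := fun v i => nat_of_bool (P v i))).
Qed.

(** Extension point of [computable_tac], redefined once decoding and [least] are known to be
    computable. *)
Ltac computable_hook := idtac.

Ltac computable_tac :=
  cbv beta; first [assumption | lazymatch goal with
  | |- computable_map _ _ (fun v => behead (@?G v)) =>
      refine (@computable_behead_map _ _ G _); computable_tac
  | |- computable_map _ _ (fun v => v) => exact: computable_id_map
  | |- computable_map _ _ id => exact: computable_id_map
  | |- computable_map _ _ (fun v => [::]) => exact: computable_nil_map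
  | |- computable_map _ _ (fun v => @?F v :: @?G v) =>
      refine (@computable_cons_map _ _ F G _ _); computable_tac
  | |- computable _ (fun v => nth 0 (@?G v) _) =>
      refine (@computable_nth _ _ G _ _ _); [computable_tac|by []]
  | |- computable _ (fun v => nat_of_bool (~~ @?P v)) =>
      refine (@computable_negb _ P _); computable_tac
  | |- computable _ (fun v => nat_of_bool (@?P v && @?Q v)) =>
      refine (@computable_andb _ P Q _ _); computable_tac
  | |- computable _ (fun v => nat_of_bool (@?P v || @?Q v)) =>
      refine (@computable_orb _ P Q _ _); computable_tac
  | |- computable _ (fun v => nat_of_bool (@?F v == @?G v)) =>
      refine (@computable_eqn _ F G _ _); computable_tac
  | |- computable _ (fun v => nat_of_bool (leq (@?F v) (@?G v))) =>
      refine (@computable_leq _ F G _ _); computable_tac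
  | |- computable _ (fun v => nat_of_bool (bex (@?F v) (@?P v))) =>
      refine (@computable_bex _ F P _ _); computable_tac
  | |- computable _ (fun v => addn (@?F v) (@?G v)) =>
      refine (@computable_addn _ F G _ _); computable_tac
  | |- computable _ (fun v => muln (@?F v) (@?G v)) =>
      refine (@computable_muln _ F G _ _); computable_tac
  | |- computable _ (fun v => subn (@?F v) (@?G v)) =>
      refine (@computable_subn _ F G _ _); computable_tac
  | |- computable _ (fun v => expn (@?F v) (@?G v)) =>
      refine (@computable_expn _ F G _ _); computable_tac
  | |- computable _ (fun v => S (@?F v)) =>
      refine (@computableS _ F _); computable_tac
  | |- computable _ (fun v => predn (@?F v)) =>
      refine (@computable_predn _ F _); computable_tac
  | H : computable _ ?F |- computable _ (fun v => ?F (@?G v)) =>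
      refine (@computable_comp _ _ F G H _); computable_tac
  | H : computable _ (fun w => nat_of_bool (?F w)) |-
      computable _ (fun v => nat_of_bool (?F (@?G v))) =>
      refine (@computable_comp _ _ (fun w => nat_of_bool (F w)) G H _);
      computable_tac
  | |- computable _ (fun v => ?n) => first [exact: computable_cst | computable_hook]
  | _ => idtac
  end].

Lemma computable_prod_ord k m (F : 'I_m -> seq nat -> nat) :
  (forall i, computable k (F i)) -> computable k (fun v => \prod_(i < m) F i v).
Proof.
elim: m F => [|m IH] F Fc.
  by apply: eq_computable (computable_cst k 1) => v _; rewrite big_ord0.
apply: (@eq_computable _ (fun v => F ord0 v * \prod_(i < m) F (lift ord0 i) v)).
  by move=> v _; rewrite big_ord_recl.
by apply: computable_muln => //; exact: IH.
Qed.

(** Kleene's normal form: evaluation with [s] units of fuel is a total computable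
    function, with [0] for "no value yet" and [y.+1] for the value [y]. *)
Lemma bounded_evaluation k (c : recfun k) : exists2 F, computable k.+1 F &
  (forall s (v : k.-tuple nat) y, F (s :: v) = y.+1 -> reval c v y) /\
  (forall (v : k.-tuple nat) y, reval c v y ->
    exists s0, forall s, s0 <= s -> F (s :: v) = y.+1).
Proof.
elim: c => {k} [k||k i|k m f [F Fc [Fs Fe]] g IHg|k f [F Fc [Fs Fe]] g [G Gc [Gs Ge]]
               |k f [F Fc [Fs Fe]]].
- exists (fun=> 1); first exact: computable_cst.
  by split=> [s v y [<-]|v y ->] //; exists 0.
- exists (fun w => (nth 0 w 1).+2); first by computable_tac.
  split=> [s v y [<-]|v y ->]; first by rewrite /= /thead (tnth_nth 0).
  by exists 0 => s _; rewrite /= /thead (tnth_nth 0).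
- exists (fun w => (nth 0 w i.+1).+1).
    by apply/computableS/computable_nth; [exact: computable_id_map|rewrite ltnS].
  split=> [s v y [<-]|v y ->]; first by rewrite /= (tnth_nth 0).
  by exists 0 => s _; rewrite /= (tnth_nth 0).
- have /choice[G GP] : forall i, exists G, [/\ computable k.+1 G,
      forall s (v : k.-tuple nat) y, G (s :: v) = y.+1 -> reval (g i) v y &
      forall (v : k.-tuple nat) y, reval (g i) v y ->
      exists s0, forall s, s0 <= s -> G (s :: v) = y.+1].
    by move=> i; have [G Gc [Gs Ge]] := IHg i; exists G.
  pose Gm w := [seq (G i w).-1 | i <- enum 'I_m].
  (* The product is nonzero exactly when every inner evaluation has produced a value; the [.-1] in
     [Gm] recovers these values. *)
  exists (fun w => if 0 < \prod_(i < m) G i w then F (nth 0 w 0 :: Gm w) else 0).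
    apply: computable_if; last exact: computable0.
      apply: computable_leq; first exact: computable_cst.
      by apply: computable_prod_ord => i; have [] := GP i.
    apply: (computable_comp Fc (G := fun w => _ :: _)).
    apply: computable_cons_map; first by computable_tac.
    split=> [v _|i im]; first by rewrite size_map size_enum_ord.
    apply: (@eq_computable _ (fun w => (G (Ordinal im) w).-1)).
      move=> v _; rewrite (nth_map (Ordinal im)) ?size_enum_ord //.
      by congr (G _ _).-1; apply: val_inj; rewrite /= nth_enum_ord.
    by apply: computable_predn; have [] := GP (Ordinal im).
  have Gmi w (i : 'I_m) : nth 0 (Gm w) i = (G i w).-1.
    by rewrite (nth_map i) ?size_enum_ord // nth_ord_enum.
  have Gms w : size (Gm w) == m by rewrite size_map size_enum_ord.
  split=> [s v y|v y /= [w [gw fw]]].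
    case: ifP => // prod_gt0 Fy; exists (Tuple (Gms (s :: v))).
    split=> [i|]; last exact: (Fs s (Tuple (Gms (s :: v)))) Fy.
    have [_ Gi _] := GP i; apply: (Gi s); rewrite (tnth_nth 0) Gmi prednK //.
    rewrite lt0n; apply: contraL prod_gt0 => /eqP Gi0.
    by rewrite (bigD1 i) //= Gi0 mul0n.
  have /choice[s0 s0P] : forall i, exists s0, forall s, s0 <= s ->
      G i (s :: v) = (tnth w i).+1.
    by move=> i; have [_ _] := GP i; apply; exact: gw.
  have [s1 s1P] := Fe w y fw.
  exists (maxn s1 (\max_(i < m) s0 i)) => s; rewrite geq_max => /andP[s1s s0s].
  have Gw i : G i (s :: v) = (tnth w i).+1.
    by apply: s0P; apply: leq_trans s0s; exact: leq_bigmax.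
  rewrite (_ : Gm (s :: v) = w); last first.
    apply: (@eq_from_nth _ 0); first by rewrite (eqP (Gms _)) size_tuple.
    move=> i; rewrite (eqP (Gms _)) => im.
    by rewrite (Gmi _ (Ordinal im)) Gw (tnth_nth 0).
  by rewrite s1P // prodn_gt0 // => i; rewrite Gw.
(* A step that has no value yet gives 0, and this 0 propagates to all later steps. *)
- pose H (w : seq nat) i r :=
    if 0 < r then G (nth 0 w 0 :: i :: r.-1 :: behead w) else 0.
  exists (fun w => nat_rect _ (F (nth 0 w 0 :: behead (behead w)))
    (H (nth 0 w 0 :: behead (behead w))) (nth 0 w 1)).
    apply: (computable_rec (H := fun v => H (nth 0 v 0 :: behead (behead v)))).
    + by computable_tac.
    + by computable_tac.
    + by rewrite /H /=; apply: computable_if; computable_tac.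
  split=> [s w y|w y]; case/tupleP: w => n v; last move=> /= [u [fu gu ->]].
    set r := nat_rect _ _ _; change (r n = y.+1 -> reval (Prec f g) [tuple of n :: v] y).
    move=> ry; have r_pos i j : i <= j -> 0 < r j -> 0 < r i.
      elim: j => [|j IH]; first by rewrite leqn0 => /eqP->.
      rewrite leq_eqVlt => /predU1P[->//|/IH]; move=> {}IH rS; apply: IH.
      by move: rS; rewrite [r j.+1]/= {1}/H; case: (posnP (r j)).
    have r_gt0 i : i <= n -> 0 < r i by move=> /r_pos; apply; rewrite ry.
    exists (fun i => (r i).-1); split=> /=.
    + by apply: (Fs s); rewrite prednK //; exact: (r_gt0 0).
    + move=> i i_lt; apply: (Gs s); rewrite prednK; last exact: (r_gt0 i.+1).
      by rewrite {1}/H r_gt0 // ltnW.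
    + by rewrite /thead /tnth /= ry.
  rewrite /thead /tnth /= in gu *.
  suff main i : i <= n -> exists s0, forall s, s0 <= s ->
      nat_rect _ (F (s :: v)) (H (s :: v)) i = (u i).+1 by exact: main.
  elim: i => [_|i IH i_lt]; first by have [s0 s0P] := Fe _ _ fu; exists s0.
  have [s0 s0P] := IH (ltnW i_lt); have [s1 s1P] := Ge _ _ (gu i i_lt).
  exists (maxn s0 s1) => s; rewrite geq_max => /andP[s0s s1s] /=.
  by rewrite s0P // /H /= s1P.
(* [E w y] means that [F] has produced the value 0 at [y] and a nonzero value at each smaller
   argument. At most one [y] qualifies, so the sum below is [y.+1] or 0. *)
- pose E w y := (F (nth 0 w 0 :: y :: behead w) == 1) &&
    ~~ bex y (fun i => F (nth 0 w 0 :: i :: behead w) <= 1).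
  exists (fun w => \sum_(y < nth 0 w 0) y.+1 * E w y).
    apply: (computable_sum (H := fun w y => y.+1 * E w y)); rewrite /E;
    by computable_tac.
  have EP s (v : k.-tuple nat) y : E (s :: v) y -> reval (Mu f) v y.
    move=> /andP[/eqP Fy /bexP Fi]; split=> [|i i_lt]; first exact: (Fs s).
    case Fsi : (F (s :: i :: v)) => [|[|z]].
    + by case: Fi; exists i; rewrite //= Fsi.
    + by case: Fi; exists i; rewrite //= Fsi.
    + by exists z; exact: (Fs s).
  have Ey s (v : k.-tuple nat) y : y < s -> E (s :: v) y ->
      \sum_(z < s) z.+1 * E (s :: v) z = y.+1.
    move=> y_lt Ey; rewrite (bigD1 (Ordinal y_lt)) //= Ey muln1.
    rewrite big1 ?addn0 // => z; rewrite -(inj_eq val_inj) /= => zy.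
    case Ez : (E (s :: v) z); last by rewrite muln0.
    move: Ey Ez; rewrite /E /= => /andP[/eqP Fy /bexP Fi] /andP[/eqP Fz /bexP Fj].
    case: (ltngtP z y) zy => // [zy|yz] _.
    + by case: Fi; exists z; rewrite ?Fz.
    + by case: Fj; exists y; rewrite ?Fy.
  split=> [s v y|v y [fy fi]] /=.
    have [/existsP[z Ez]|/existsPn E0] := boolP [exists z : 'I_s, E (s :: v) z].
      by rewrite (Ey _ _ z) // => -[<-]; exact: EP Ez.
    by rewrite big1 // => z _; rewrite (negbTE (E0 z)) muln0.
  have [s0 s0P] := Fe _ _ fy.
  have /choice[s1 s1P] : forall i : 'I_y, exists s1, forall s, s1 <= s ->
      1 < F (s :: nat_of_ord i :: v).
    move=> i; have [z /Fe[s1 s1P]] := fi i (ltn_ord i).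
    by exists s1 => s /s1P /= ->.
  exists (maxn y.+1 (maxn s0 (\max_(i < y) s1 i))) => s.
  rewrite !geq_max => /and3P[ys s0s s1s]; apply: Ey => //.
  rewrite /E /= s0P //=; apply/bexP => -[i i_lt]; apply/negP; rewrite -ltnNge.
  apply: (s1P (Ordinal i_lt)); apply: leq_trans s1s.
  exact: (leq_bigmax (Ordinal i_lt)).
Qed.

(** In one direction the stage [s] is the fuel of a bounded evaluation. In the other, [Mu] searches
    for a zero, so it is run on the negation of [P]. *)
Lemma rec_enumP k (A : set (k.-tuple nat)) : rec_enum A <->
  exists2 P, computable k.+1 (fun w => nat_of_bool (P w)) &
    forall v : k.-tuple nat, A v <-> exists s, P (s :: v).
Proof.
split=> [[c cP]|[P Pc PA]].
  have [F Fc [Fs Fe]] := bounded_evaluation c.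
  exists (fun w => 0 < F w); first by computable_tac.
  move=> v; rewrite cP; split=> [[y /Fe[s sP]]|[s]].
    by exists s; rewrite sP.
  by case Fsv : (F (s :: v)) => [//|y] _; exists y; exact: (Fs s).
have [c cP] := computable_negb Pc.
exists (Mu c) => v; rewrite PA; split=> [/ex_minnP[s Ps smin]|[s [/cP]]].
  exists s; split=> [|i i_lt]; first by apply/cP; rewrite /= Ps.
  exists 0; apply/cP => /=; case Pi : (P (i :: v)) => //.
  by move: i_lt; rewrite ltnNge smin.
by case Ps : (P _) => // _ _; exists s.
Qed.

(** * Division and decoding of finite sequences *)

Lemma computable_dvdn k F G : computable k F -> computable k G ->
  computable k (fun v => nat_of_bool (F v %| G v)).
Proof.
move=> Fc Gc; apply: (@eq_computable _
    (fun v => bex (G v).+1 (fun q => G v == q * F v))); last by computable_tac.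
move=> v _; congr nat_of_bool; apply/bexP/dvdnP => [[q _ /eqP ->]|[q Gq]].
  by exists q.
have [F0|F_gt0] := posnP (F v); first by exists 0; rewrite // Gq F0 !muln0.
by exists q; [rewrite ltnS Gq leq_pmulr|rewrite Gq].
Qed.

Lemma sum_ltn n m : \sum_(i < n) (i < m) = minn n m.
Proof.
elim: n => [|n IH]; first by rewrite big_ord0 min0n.
by rewrite big_ord_recr /= IH; case: ltnP => nm; lia.
Qed.

Lemma computable_divn k F G : computable k F -> computable k G ->
  computable k (fun v => F v %/ G v).
Proof.
move=> Fc Gc; apply: (@eq_computable _
    (fun v => \sum_(q < F v) ((0 < G v) && (q.+1 * G v <= F v)))); last first.
  apply: (@computable_sum _ _ (fun v q => (0 < G v) && (q.+1 * G v <= F v))) => //.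
  by computable_tac.
move=> v _; have [->|G_gt0] := posnP (G v); first by rewrite divn0 big1.
under eq_bigr => q _ do rewrite /= -leq_divRL //.
by rewrite sum_ltn; apply/minn_idPr; exact: leq_div.
Qed.

(** The code of [a :: s] is 2^a * (2 * c + 1) with c the code of [s]. The head is thus the exponent
    of 2 in [n], found by counting the powers 2, 4, 8, ... that divide [n]. *)
Definition head_code n := \sum_(e < n) (2 ^ e.+1 %| n).
Definition behead_code n := n %/ 2 ^ head_code n %/ 2.
Definition nth_code n j := head_code (iter j behead_code n).

Lemma head_codeE a s : head_code (CodeSeq.code (a :: s)) = a.
Proof.
rewrite /head_code; set n := CodeSeq.code _.
have dvd_n e : (2 ^ e %| n) = (e <= a).
  rewrite /n /=; have [ea|ae] := leqP e a; first by rewrite dvdn_mulr ?dvdn_exp2l.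
  rewrite -(subnK ae) addnS expnS addnC expnD mulnCA dvdn_pmul2l ?expn_gt0 //.
  apply/negP => /(dvdn_trans (dvdn_mulr _ (dvdnn 2))).
  by rewrite dvdn2 /= odd_double.
have a_le : a <= n.
  by apply: (leq_trans (ltnW (ltn_expl a (isT : 1 < 2)))); exact: leq_pmulr.
by under eq_bigr => e _ do rewrite dvd_n; rewrite sum_ltn; exact/minn_idPr.
Qed.

Lemma behead_codeE a s :
  behead_code (CodeSeq.code (a :: s)) = CodeSeq.code s.
Proof.
rewrite /behead_code head_codeE /= mulKn ?expn_gt0 //.
by rewrite -muln2 -addn1 divnMDl // addn0.
Qed.

(** Past the end of the list the code has become 0, whose head and tail are again 0, in agreement
    with the default value of [nth]. *)
Lemma nth_codeE n j : nth_code n j = nth 0 (CodeSeq.decode n) j.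
Proof.
rewrite -{1}[n]CodeSeq.decodeK; elim: j (CodeSeq.decode n) => [|j IH] [|a s].
- by rewrite /nth_code /head_code big_ord0.
- by rewrite /nth_code head_codeE.
- rewrite nth_nil /nth_code (_ : iter _ _ _ = 0) /head_code ?big_ord0 //.
  elim: j.+1 => [|i /= ->] //.
  by rewrite /behead_code div0n div0n.
- by rewrite /nth_code iterSr behead_codeE -/(nth_code _ _) IH.
Qed.

Lemma computable_nth_code k F G : computable k F -> computable k G ->
  computable k (fun v => nth_code (F v) (G v)).
Proof.
have head_c m H : computable m H -> computable m (fun v => head_code (H v)).
  move=> Hc; apply: (@computable_sum _ _ (fun v e => 2 ^ e.+1 %| H v)) => //.
  by apply: computable_dvdn; computable_tac.
move=> Fc Gc; apply: (head_c) => //.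
apply: (@eq_computable _
    (fun v => nat_rect _ (F v) (fun _ => behead_code) (G v))).
  by move=> v _; elim: (G v) => //= j ->.
apply: computable_rec => //; rewrite /behead_code.
apply: computable_divn; last exact: computable_cst.
apply: computable_divn; first by computable_tac.
apply: computable_expn; first exact: computable_cst.
by apply: head_c; computable_tac.
Qed.

Lemma size_decode n : size (CodeSeq.decode n) <= n.
Proof.
rewrite -{2}[n]CodeSeq.decodeK; elim: (CodeSeq.decode n) => //= a s IH.
rewrite (leq_trans (_ : _ <= (CodeSeq.code s).*2.+1)) ?leq_pmull ?expn_gt0 //.
by rewrite ltnS (leq_trans IH) // -addnn leq_addr.
Qed.

(** In the numbering [ratnum] this stands for a / (c + 1), so that for positive D the rational a / D
    has the code [fraction_code a D.-1]. *)
Definition fraction_code a c := CodeSeq.code [:: a; 0; c].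

Lemma computable_fraction_code k F G : computable k F -> computable k G ->
  computable k (fun v => fraction_code (F v) (G v)).
Proof.
move=> Fc Gc.
apply: (@eq_computable _ (fun v => 2 ^ F v * (2 * (2 * 2 ^ G v).+1).+1)).
  by move=> v _; rewrite /fraction_code /= muln1 mul1n !mul2n.
by computable_tac.
Qed.

(** Minimisation as a relation: it is decidable together with [Q], even if [Q] never holds. *)
Definition least (Q : nat -> bool) n := Q n && ~~ bex n Q.

Lemma least_inj Q m n : least Q m -> least Q n -> m = n.
Proof.
move=> /andP[Qm /bexP nQm] /andP[Qn /bexP nQn]; case: (ltngtP m n) => // lt_mn.
- by case: nQn; exists m.
- by case: nQm; exists n.
Qed.

Lemma least_exists (Q : nat -> bool) n : Q n -> exists2 m, m <= n & least Q m.
Proof.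
move=> Qn; have exQ : exists n, Q n by exists n.
case: (ex_minnP exQ) => m Qm m_min; exists m; first exact: m_min.
rewrite /least Qm; apply/bexP => -[i i_lt /m_min].
by rewrite leqNgt i_lt.
Qed.

Lemma computable_least k Q N :
  computable k.+1 (fun w => nat_of_bool (Q (behead w) (nth 0 w 0))) ->
  computable k N -> computable k (fun v => nat_of_bool (least (Q v) (N v))).
Proof.
move=> Qc Nc; apply: computable_andb.
  apply: (computable_comp Qc (G := fun v => N v :: v)).
  exact/computable_cons_map/computable_id_map.
exact/computable_negb/computable_bex.
Qed.

(** This counts the numbers that a test selects at one level: each index below [g] contributes at
    most one. *)
Lemma functional_image (Q : nat -> nat -> Prop) g :
  (forall i m n, Q i m -> Q i n -> m = n) ->
  exists2 s : seq nat, size s <= g & forall i n, i < g -> Q i n -> n \in s.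
Proof.
move=> Qf; elim: g => [|g [s sg sP]]; first by exists [::].
have [[n Qn]|nQ] := pselect (exists n, Q g n).
  exists (n :: s) => // i m; rewrite ltnS leq_eqVlt => /predU1P[->|ig] Qm.
    by rewrite (Qf _ _ _ Qm Qn) mem_head.
  by rewrite inE (sP i) ?orbT.
exists s => [|i m]; first exact: leqW.
rewrite ltnS leq_eqVlt => /predU1P[->|ig]; last exact: sP.
by move=> Qm; case: nQ; exists m.
Qed.

Ltac computable_hook ::=
  lazymatch goal with
  | |- computable _ (fun v => nth_code (@?F v) (@?G v)) =>
      refine (@computable_nth_code _ F G _ _); computable_tac
  | |- computable _ (fun v => fraction_code (@?F v) (@?G v)) =>
      refine (@computable_fraction_code _ F G _ _); computable_tac
  | |- computable _ (fun v => nat_of_bool (least (@?Q v) (@?N v))) =>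
      refine (@computable_least _ Q N _ _); computable_tac
  | _ => idtac
  end.

(** * Probability measures on the compactification *)

Local Open Scope ring_scope.

(** The natural numbers are isolated, so every set of them is open, and the singleton of infinity is
    the complement of an open set. *)
Lemma measurable_Nbar (A : set Nbar) : measurable A.
Proof.
have mSome (B : set nat) : measurable ((Some @` B) : set Nbar).
  apply: sub_sigma_algebra; apply: one_point_compactification_open_some.
  by rewrite openE => x Bx; exact/principal_filterP.
have mNone : measurable ([set None] : set Nbar).
  rewrite (_ : [set None] = ~` ((Some @` setT) : set Nbar)); first exact: measurableC.
  apply/seteqP; split=> [_ -> [] //|[n|//] nS]; exfalso; apply: nS; by exists n.
rewrite (_ : A = (Some @` (Some @^-1` A)) `|` (A `&` [set None])).
  apply: measurableU => //; have [AN|nAN] := pselect (A None).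
    by rewrite (_ : _ `&` _ = [set None]) //; apply/seteqP; split=> [x []|x /= ->].
  rewrite (_ : _ `&` _ = set0); first exact: measurable0.
  by apply/seteqP; split=> [x [/[swap] /= ->]|].
by apply/seteqP; split=> [[n|] Ax|x [[n An <-]|[]]] //; [left; exists n|right].
Qed.

#[local] Hint Resolve measurable_Nbar : core.

Section measures.
Context {R : realType}.
Implicit Types (mu nu : probability Nbar R) (A B : set Nbar) (e p : R).

Definition pr mu A : R := fine (mu A).

Lemma prE mu A : mu A = (pr mu A)%:E.
Proof. by rewrite /pr fineK // fin_num_measure. Qed.

Lemma pr_ge0 mu A : 0 <= pr mu A.
Proof. by rewrite -lee_fin -prE. Qed.

Lemma pr_le mu A B : A `<=` B -> pr mu A <= pr mu B.
Proof. by move=> AB; rewrite -lee_fin -!prE le_measure ?inE. Qed.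

Lemma pr_le1 mu A : pr mu A <= 1.
Proof. by rewrite -lee_fin -prE probability_le1. Qed.

Lemma prC mu A : pr mu (~` A) = 1 - pr mu A.
Proof. by apply: EFin_inj; rewrite -prE probability_setC // EFinB -prE. Qed.

Lemma prU mu A B : A `&` B = set0 -> pr mu (A `|` B) = pr mu A + pr mu B.
Proof. by move=> AB; apply: EFin_inj; rewrite -prE measureU // EFinD -!prE. Qed.

Lemma prU_le mu A B : pr mu (A `|` B) <= pr mu A + pr mu B.
Proof.
rewrite (_ : A `|` B = A `|` (B `\` A)); last by rewrite setUDr setDv setD0.
by rewrite prU ?setDIK // lerD2l pr_le.
Qed.

Lemma pr0 mu : pr mu set0 = 0.
Proof. by rewrite /pr measure0. Qed.

Definition atom (n : nat) : set Nbar := [set Some n].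

Definition initial M : set Nbar := [set x | if x is Some m then (m < M)%N else False].

Lemma initialS M : initial M.+1 = initial M `|` atom M.
Proof.
apply/seteqP; split=> [[m|] //=|[m|] [//|//]] /=.
- by rewrite ltnS leq_eqVlt => /predU1P[->|]; [right|left].
- by move=> /ltnW; rewrite ltnS.
- by move=> [->].
Qed.

Lemma pr_initial mu M : pr mu (initial M) = \sum_(n < M) pr mu (atom n).
Proof.
elim: M => [|M IH]; first by rewrite big_ord0 -(pr0 mu); congr pr; apply/seteqP; split=> -[].
rewrite initialS big_ord_recr /= prU ?IH //.
by apply/seteqP; split=> [_ [/= /[swap] -> /=]|//]; rewrite ltnn.
Qed.

Lemma Nbar_dist_sym (x y : Nbar) : Nbar_dist R x y = Nbar_dist R y x.
Proof. exact: distrC. Qed.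

(** The point nearest to 1 / (n + 1) is 1 / (n + 2), at distance 1 / ((n + 1)(n + 2)). *)
Lemma Nbar_dist_isolated n e (y : Nbar) : e * (n.+1 * n.+2)%:R <= 1 ->
  Nbar_dist R (Some n) y < e -> y = Some n.
Proof.
move=> e_le d_lt; apply: contrapT => yn.
have gap (a b : nat) : (0 < a < b)%N -> (a * a.+1)%:R^-1 <= a%:R^-1 - b%:R^-1 :> R.
  move=> /andP[a0 ab]; rewrite (_ : (a * a.+1)%:R^-1 = a%:R^-1 - a.+1%:R^-1).
    by rewrite lerD2l lerN2 lef_pV2 ?posrE ?ltr0n ?ler_nat //; lia.
  by rewrite natrM -natr1; field; rewrite natr1 !pnatr_eq0; lia.
suff : (n.+1 * n.+2)%:R^-1 <= Nbar_dist R (Some n) y.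
  move=> /le_lt_trans /(_ d_lt); rewrite -[X in X < _]mul1r ltr_pdivrMr ?ltr0n //.
  by rewrite ltNge e_le.
rewrite /Nbar_dist; case: y yn {d_lt} => [k yn|_] /=; last first.
  rewrite subr0 ger0_norm // lef_pV2 ?posrE ?ltr0n // ler_nat; exact: leq_pmulr.
case: (ltngtP k n) yn => [kn|nk|-> //] _; last first.
  by rewrite (le_trans (gap n.+1 k.+1 _)) ?ler_norm // ltnS.
rewrite distrC; apply: le_trans (ler_norm _).
apply: le_trans (gap k.+1 n.+1 _); last by rewrite ltnS.
by rewrite lef_pV2 ?posrE ?ltr0n // ler_nat leq_mul // ltnS // ltnW.
Qed.

Lemma thickening_point n e : e * (n.+1 * n.+2)%:R <= 1 ->
  thickening (atom n) e `<=` atom n.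
Proof.
by move=> e_le x [_ -> /= xn]; apply: Nbar_dist_isolated e_le _; rewrite Nbar_dist_sym.
Qed.

Lemma thickening_initial M e : e * (M * M.+1)%:R <= 1 ->
  thickening (initial M) e `<=` initial M.
Proof.
move=> e_le x [[m|//] /= mM xm]; suff -> : x = Some m by [].
apply: (@Nbar_dist_isolated m e); last by rewrite Nbar_dist_sym.
have [e0|/ltW e0] := lerP e 0.
  by rewrite (le_trans (_ : _ <= 0)) // mulr_le0_ge0.
by apply: le_trans e_le; rewrite ler_wpM2l // ler_nat leq_mul.
Qed.

Lemma thickeningC A e : thickening A e `<=` A -> thickening (~` A) e `<=` ~` A.
Proof.
by move=> Ae x [y nAy xy] Ax; apply: nAy; apply: Ae; exists x; rewrite // Nbar_dist_sym.
Qed.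

Lemma prokhorov_lt mu nu p : prokhorov mu nu < p ->
  exists2 e, 0 < e < p & forall A, pr mu A <= pr nu (thickening A e) + e.
Proof.
move=> /inf_lt[|e [e0 eP] ep].
  (* The infimum runs over a nonempty set, since 1 belongs to it. *)
  exists 1; split=> // A _; rewrite (prE mu) (prE nu) -EFinD lee_fin.
  by rewrite (le_trans (pr_le1 _ _)) // lerDr pr_ge0.
exists e; rewrite ?e0 // => A; rewrite -lee_fin EFinD -!prE; exact: eP.
Qed.

Lemma prokhorov_le mu nu e : 0 < e ->
  (forall A, pr mu A <= pr nu (thickening A e) + e) -> prokhorov mu nu <= e.
Proof.
move=> e0 eP; apply: ge_inf.
  by exists 0 => x [x0 _]; exact: ltW.
by split=> // A _; rewrite (prE mu) (prE nu) -EFinD lee_fin.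
Qed.

(** The complement of [A] absorbs its thickening as well; the Prokhorov inequality for [A] and for
    its complement gives the two bounds. *)
Lemma prokhorov_pr mu nu p A : prokhorov mu nu < p -> thickening A p `<=` A ->
  `|pr mu A - pr nu A| < p.
Proof.
move=> /prokhorov_lt[e /andP[e0 ep] eP] Ap.
have Ae : thickening A e `<=` A.
  by move=> x [y Ay xy]; apply: Ap; exists y => //; exact: lt_trans ep.
have := eP A; have := eP (~` A).
have := pr_le nu Ae; have := pr_le nu (thickeningC Ae).
by rewrite !prC; move=> *; rewrite ltr_norml; apply/andP; split; lra.
Qed.

Lemma sum_code i m (F : nat -> R) : (size (CodeSeq.decode i) <= m)%N ->
  \sum_(j < m) (nth_code i j)%:R * F j =
  \sum_(j < size (CodeSeq.decode i)) (nth_code i j)%:R * F j.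
Proof.
move=> sm; rewrite [RHS](big_ord_widen _ (fun j => (nth_code i j)%:R * F j) sm).
rewrite [RHS]big_mkcond; apply: eq_bigr => j _.
by rewrite nth_codeE; case: ltnP => // /(nth_default 0%N)->; rewrite mul0r.
Qed.

(** The bound [i] is at least the length of the coded list and missing entries count as 0, so this
    is the total weight in a visibly computable form. *)
Definition code_weight i := (\sum_(j < i) nth_code i j)%N.

Lemma basic_measureE i m A : (size (CodeSeq.decode i) <= m)%N ->
  (0 < code_weight i)%N -> pr (basic_measure R i) A =
  (\sum_(j < m) (nth_code i j)%:R * \1_A (Nbar_point j)) / (code_weight i)%:R.
Proof.
move=> sm w0; rewrite (sum_code (fun j => \1_A (Nbar_point j)) sm) {m sm}.
rewrite /pr /basic_measure /= /mnormalize /=; set M := msum _ _.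
have ME B : M B = (\sum_(j < size (CodeSeq.decode i))
    (nth_code i j)%:R * \1_B (Nbar_point j))%:E.
  rewrite -sumEFin; apply: eq_bigr => j _.
  by rewrite nth_codeE EFinM.
have MT : M setT = (code_weight i)%:R%:E.
  rewrite ME -(sum_code (fun j => \1_setT (Nbar_point j)) (size_decode i)) natr_sum; congr EFin.
  by apply: eq_bigr => j _; rewrite indicT mulr1.
by rewrite MT eqe pnatr_eq0 (gtn_eqF w0) /= ME -EFinM.
Qed.

Lemma basic_measure_atom i n : (0 < code_weight i)%N ->
  pr (basic_measure R i) (atom n) = (nth_code i n.+1)%:R / (code_weight i)%:R.
Proof.
move=> w0; rewrite (@basic_measureE i (i + n.+2)) //; last first.
  by rewrite (leq_trans (size_decode i)) ?leq_addr.
have n_lt : (n.+1 < i + n.+2)%N by rewrite addnS ltnS leq_addl.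
rewrite (bigD1 (Ordinal n_lt)) //= indicE mem_set // mulr1 big1 ?addr0 // => j.
rewrite -(inj_eq val_inj) /= => jn; rewrite indicE memNset ?mulr0 //.
by case: (nat_of_ord j) jn => [|k] // kn [kn']; rewrite kn' eqxx in kn.
Qed.

Lemma basic_measure_initial i M : (0 < code_weight i)%N ->
  pr (basic_measure R i) (initial M) =
  (\sum_(n < M) nth_code i n.+1)%:R / (code_weight i)%:R.
Proof.
move=> w0; rewrite pr_initial natr_sum mulr_suml.
by apply: eq_bigr => n _; rewrite basic_measure_atom.
Qed.

(** Round the masses of the first K numbers down to multiples of 1 / D and put the remaining weight
    at infinity. Rounding costs at most K / D < e in total, and the numbers from K on are closer
    than e to infinity. *)
Lemma basic_measure_dense mu e : 0 < e ->
  exists2 i, (0 < code_weight i)%N & prokhorov mu (basic_measure R i) <= e.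
Proof.
move=> e0; pose K := Num.trunc e^-1; pose D := (K.+1 * K.+1)%N.
have Ke : K.+1%:R^-1 < e.
  by rewrite -[ltRHS]invrK ltf_pV2 ?posrE ?invr_gt0 ?ltr0n // truncnS_gt.
have D0 : 0 < D%:R :> R by rewrite ltr0n.
have KD : K%:R / D%:R < e.
  apply: le_lt_trans Ke; rewrite natrM invfM mulrA ler_piMl ?invr_ge0 //.
  by rewrite ler_pdivrMr ?ltr0n // mul1r ler_nat.
pose f n := Num.trunc (D%:R * pr mu (atom n)).
have f_itv n : (f n)%:R / D%:R <= pr mu (atom n) <= (f n)%:R / D%:R + D%:R^-1.
  have := truncn_itv (mulr_ge0 (ltW D0) (pr_ge0 mu (atom n))).
  rewrite -/(f n) -natr1 => /andP[fl /ltW fu].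
  by rewrite -[X in _ + X]mul1r -mulrDl ler_pdivrMr // ler_pdivlMr // mulrC fl.
have sum_f : \sum_(n < K) (f n)%:R / D%:R <= pr mu (initial K).
  by rewrite pr_initial ler_sum // => n _; have /andP[] := f_itv n.
pose F := (\sum_(n < K) f n)%N.
have FD : (F <= D)%N.
  rewrite -(ler_nat R) -[leRHS]mul1r -ler_pdivrMr //; apply: le_trans (pr_le1 mu (initial K)).
  by rewrite natr_sum mulr_suml.
pose w := (D - F)%N :: mkseq f K; pose i := CodeSeq.code w.
have wE j : nth_code i j = nth 0%N w j by rewrite nth_codeE CodeSeq.codeK.
have sw : size (CodeSeq.decode i) = K.+1 by rewrite CodeSeq.codeK /= size_mkseq.
have wS (n : 'I_K) : nth_code i n.+1 = f n by rewrite wE /= nth_mkseq.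
have iD : code_weight i = D.
  apply/eqP; rewrite -(eqr_nat R) natr_sum.
  under eq_bigr do rewrite -[_%:R]mulr1.
  rewrite (@sum_code i i (fun=> 1)) ?size_decode // sw big_ord_recl wE /=.
  under eq_bigr => n _ do rewrite wS mulr1.
  by rewrite mulr1 -natr_sum -natrD subnK.
exists i; first by rewrite iD.
apply: prokhorov_le => // A.
rewrite (@basic_measureE i K.+1) ?sw ?iD // big_ord_recl wE /=.
under eq_bigr => n _ do rewrite wS /= add0n.
have le1 k : pr mu (A `&` initial k) <=
    \sum_(n < k) ((f n)%:R / D%:R + D%:R^-1) * \1_A (Some (nat_of_ord n) : Nbar).
  elim: k => [|k IH].
    rewrite big_ord0 (_ : _ `&` _ = set0) ?pr0 //.
    by apply/seteqP; split=> [[m|] [_ /=]|x []].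
  rewrite big_ord_recr /= initialS setIUr; apply: le_trans (prU_le _ _ _) _.
  apply: lerD; first exact: IH.
  rewrite indicE; case: (boolP (_ \in _)) => [_|kA].
    rewrite mulr1; have /andP[_ h] := f_itv k; by apply: le_trans h; apply: pr_le => x [].
  rewrite (_ : _ `&` _ = set0) ?pr0 ?mulr0 //.
  by apply/seteqP; split=> // x [+ xk]; rewrite xk => /mem_set; exact/negP.
(* If [A] meets the tail, then infinity lies in the thickening of [A], and its weight covers the
   mass of the whole tail. *)
have le2 : pr mu (A `\` initial K) <=
    (D - F)%:R / D%:R * \1_(thickening A e) (None : Nbar).
  have [[x [Ax xK]]|nA] := pselect ((A `\` initial K) !=set0).
    rewrite indicE mem_set ?mulr1; last first.
      exists x => //; rewrite Nbar_dist_sym /Nbar_dist /= subr0.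
      case: x xK {Ax} => [m /= /negP|]; last by rewrite normr0.
      rewrite -leqNgt => Km; rewrite ger0_norm //; apply: le_lt_trans Ke.
      by rewrite lef_pV2 ?posrE ?ltr0n // ler_nat ltnS.
    apply: le_trans (pr_le _ (@subDsetr _ A (initial K))) _.
    rewrite prC natrB // mulrBl divff ?gt_eqF // lerD2l lerN2.
    by rewrite natr_sum mulr_suml.
  rewrite (_ : _ `\` _ = set0) ?pr0 ?mulr_ge0 //.
  by apply: contrapT => /eqP/set0P.
have -> : pr mu A = pr mu (A `&` initial K) + pr mu (A `\` initial K).
  rewrite -prU; first rewrite setUC -[in LHS](setDKU (@subIsetl _ A (initial K))).
    by rewrite setDIr setDv set0U.
  by apply/seteqP; split=> [x [[_ Kx] [_ /(_ Kx)]]|].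
have le3 : \sum_(n < K) ((f n)%:R / D%:R + D%:R^-1) * \1_A (Some (nat_of_ord n) : Nbar) <=
    (\sum_(n < K) (f n)%:R * \1_(thickening A e) (Some (nat_of_ord n) : Nbar)) / D%:R
    + K%:R / D%:R :> R.
  have -> : K%:R / D%:R = \sum_(n < K) D%:R^-1 :> R.
    by rewrite sumr_const card_ord mulr_natl.
  rewrite mulr_suml -big_split /= ler_sum // => n _; rewrite !indicE.
  case: (boolP (_ \in A)) => [/set_mem nA|_]; last first.
    by rewrite mulr0 addr_ge0 ?invr_ge0 ?mulr_ge0 // ltW.
  rewrite mem_set ?mulr1 //; exists (Some (nat_of_ord n)) => //.
  by rewrite /Nbar_dist subrr normr0.
apply: le_trans (lerD (le1 K) le2) _.
rewrite mulrDl (mulrAC _ (\1__ _)); move: le3 KD; lra.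
Qed.
End measures.

(** * A family of randomness tests *)

Lemma ratr_ratnum (R : realType) n : ratr (ratnum n) =
  ((nth_code n 0)%:R - (nth_code n 1)%:R) / (nth_code n 2).+1%:R :> R.
Proof.
by rewrite /ratnum -!nth_codeE rmorphM rmorphB fmorphV /= !ratr_nat.
Qed.

Lemma ratr_fraction_code (R : realType) a c :
  ratr (ratnum (fraction_code a c)) = a%:R / c.+1%:R :> R.
Proof. by rewrite ratr_ratnum !nth_codeE CodeSeq.codeK /= subr0. Qed.

Lemma ratr_ratnum_lt (R : realType) r m : (ratr (ratnum r) < m%:R :> R) =
  (nth_code r 0 < nth_code r 1 + m * (nth_code r 2).+1)%N.
Proof.
by rewrite ratr_ratnum ltr_pdivrMr ?ltr0n // ltrBlDl -natrM -natrD ltr_nat.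
Qed.

Section test.
Context {R : realType}.
Variables (G : seq nat -> bool) (fM fc fd : nat -> nat).

(** [G] proposes [n] at level [l] and stage [s], on the guess that [fc l] times the mass of [0,
    [fM l]) lies strictly between i - 1 and i + 1. These overlapping open intervals leave no value
    out, and each value lies in at most two. When [fc l] is 0 the guess is right exactly for i = 0,
    so the measure is not consulted. *)
Definition admissible (mu : probability Nbar R) l n := exists s i : nat,
  [/\ G [:: s; l; i; n], (fd l)%:R * pr mu (atom n) < 1 &
      i%:R < (fc l)%:R * pr mu (initial (fM l)) + 1 < i.+2%:R].

Definition admissible_set mu l : set Nbar :=
  [set x | exists2 n, x = Some n & admissible mu l n].

Definition test mu (x : Nbar) : \bar R :=
  ereal_sup (0%E |` [set y | exists2 l, y = (2 ^ l)%:R%:E & admissible_set mu l x]).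

(* The ball of radius [1 / P] around the basic measure number [b] consists of
   measures satisfying the inequalities in [admissible mu l n]. *)
Definition admissible_ball b P l i n : bool :=
  let S := code_weight b in
  let X := nth_code b n.+1 in
  let Y := (\sum_(m < fM l) nth_code b m.+1)%N in
  [&& 0 < S, n.+1 * n.+2 <= P, fM l * (fM l).+1 <= P,
      fd l * (X * P + S) < S * P, i * (S * P) + fc l * S < fc l * (Y * P) + S * P
    & fc l * (Y * P + S) + S * P < i.+2 * (S * P)]%N.

(** The inequalities, with a margin of 1 / P on each mass, are cleared of denominators by the factor
    [code_weight b] times P. *)
Lemma admissible_ballE b P l i n :
  let x := pr (basic_measure R b) (atom n) in
  let y := pr (basic_measure R b) (initial (fM l)) in
  let c := (fc l)%:R in
  admissible_ball b P l i n <->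
  [/\ (0 < code_weight b)%N, (n.+1 * n.+2 <= P)%N, (fM l * (fM l).+1 <= P)%N,
      (fd l)%:R * (x + P%:R^-1) < 1 &
      i%:R + c * P%:R^-1 < c * y + 1 /\ c * (y + P%:R^-1) + 1 < i.+2%:R].
Proof.
move=> x y c; rewrite /admissible_ball.
case: (posnP (code_weight b)) => [->|S0] /=; first by split=> // -[].
have [nP|nP] := leqP (n.+1 * n.+2) P; last by split=> // -[].
have P0 : (0 < P)%N by exact: leq_trans nP.
have [MP|MP] := leqP (fM l * (fM l).+1) P; last by split=> // -[].
move: (i.+2) => i2; rewrite -!(ltr_nat R) !natrD !natrM !natrD !natrM.
rewrite {}/x {}/y basic_measure_atom // basic_measure_initial //.
set s := (code_weight b)%:R; set p := P%:R; set X := (nth_code _ _)%:R.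
set Y := (\sum_(_ < _) _)%:R.
have s0 : 0 < s by rewrite ltr0n.
have p0 : 0 < p by rewrite ltr0n.
have sp0 : 0 < s * p by rewrite mulr_gt0.
have sn0 : s != 0 by rewrite gt_eqF.
have pn0 : p != 0 by rewrite gt_eqF.
have -> : ((fd l)%:R * (X * p + s) < s * p) = ((fd l)%:R * (X / s + p^-1) < 1).
  rewrite -[RHS](ltr_pM2r sp0) mul1r; congr (_ < _); field.
  by rewrite sn0 pn0.
have -> : (i%:R * (s * p) + c * s < c * (Y * p) + s * p) =
    (i%:R + c * p^-1 < c * (Y / s) + 1).
  rewrite -[RHS](ltr_pM2r sp0); congr (_ < _); field; by rewrite ?sn0 ?pn0.
have -> : (c * (Y * p + s) + s * p < i2%:R * (s * p)) =
    (c * (Y / s + p^-1) + 1 < i2%:R).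
  rewrite -[RHS](ltr_pM2r sp0); congr (_ < _); field; by rewrite ?sn0 ?pn0.
by split=> [/and5P[_ _ ? ? ?]|[_ _ _ ? [? ?]]] //; apply/and5P.
Qed.

Lemma admissible_ball_sound mu b P l i n : admissible_ball b P l i n ->
  prokhorov mu (basic_measure R b) < P%:R^-1 ->
  (fd l)%:R * pr mu (atom n) < 1 /\
  i%:R < (fc l)%:R * pr mu (initial (fM l)) + 1 < i.+2%:R.
Proof.
move=> /admissible_ballE[_ nP MP dX [cY1 cY2]] mub.
have P0 : 0 < P%:R :> R by rewrite ltr0n (leq_trans _ nP).
have := prokhorov_pr mub (@thickening_point R n _ _).
rewrite mulrC ler_pdivrMr // mul1r ler_nat => /(_ nP); rewrite ltr_norml => /andP[_ xP].
have := prokhorov_pr mub (@thickening_initial R (fM l) _ _).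
rewrite mulrC ler_pdivrMr // mul1r ler_nat => /(_ MP); rewrite ltr_norml => /andP[yP1 yP2].
split.
  by apply: le_lt_trans dX; rewrite ler_wpM2l //; lra.
have c0 : 0 <= (fc l)%:R :> R by [].
apply/andP; split.
  rewrite -(ltrD2r ((fc l)%:R / P%:R)); apply: (lt_le_trans cY1).
  by rewrite addrAC lerD2r -mulrDr ler_wpM2l //; lra.
by apply: le_lt_trans cY2; rewrite lerD2r ler_wpM2l //; lra.
Qed.

(** The inequalities are strict, with slack e. For P with 2 (c + d) / P < e, a basic measure closer
    than 1 / P to [mu] still satisfies them with the margins required of the ball. *)
Lemma admissible_ball_complete mu l i n : (fd l)%:R * pr mu (atom n) < 1 ->
  i%:R < (fc l)%:R * pr mu (initial (fM l)) + 1 < i.+2%:R ->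
  exists b P, admissible_ball b P l i n /\
              prokhorov mu (basic_measure R b) < P%:R^-1.
Proof.
set x := pr mu _; set y := pr mu _; set c := (fc l)%:R; set d := (fd l)%:R.
move=> dx /andP[cy1 cy2].
have c0 : 0 <= c :> R by [].
have d0 : 0 <= d :> R by [].
pose e : R := Num.min (1 - d * x) (Num.min (c * y + 1 - i%:R) (i.+2%:R - (c * y + 1))).
have e0 : 0 < e by rewrite !lt_min !subr_gt0 dx cy1.
pose k := Num.trunc ((2 * (c + d)) / e).
pose P := (k.+1 + n.+1 * n.+2 + fM l * (fM l).+1)%N.
have P0 : 0 < P%:R :> R by rewrite ltr0n.
pose q : R := P%:R^-1; have q0 : 0 < q by rewrite invr_gt0.
have cde : (2 * (c + d)) * q < e.
  rewrite ltr_pdivrMr // [ltRHS]mulrC -ltr_pdivrMr //.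
  by apply: (lt_le_trans (truncnS_gt _)); rewrite ler_nat /P -addnA leq_addr.
have cq0 : 0 <= c * q by rewrite mulr_ge0 // ltW.
have dq0 : 0 <= d * q by rewrite mulr_ge0 // ltW.
have [e1 e2 e3] : [/\ e <= 1 - d * x, e <= c * y + 1 - i%:R & e <= i.+2%:R - (c * y + 1)].
  by rewrite /e; split; rewrite !ge_min lexx ?orbT.
have [b wb mub] := basic_measure_dense mu (divr_gt0 q0 (ltr0n R 2)).
have {}mub : prokhorov mu (basic_measure R b) < q.
  by apply: le_lt_trans mub _; rewrite ltr_pdivrMr // ltr_pMr // ltr1n.
exists b, P; split=> //; apply/admissible_ballE.
have nP : (n.+1 * n.+2 <= P)%N by rewrite /P -addnA addnCA leq_addr.
have MP : (fM l * (fM l).+1 <= P)%N by exact: leq_addl.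
have := prokhorov_pr mub (@thickening_point R n _ _).
rewrite mulrC ler_pdivrMr // mul1r ler_nat => /(_ nP).
have := prokhorov_pr mub (@thickening_initial R (fM l) _ _).
rewrite mulrC ler_pdivrMr // mul1r ler_nat => /(_ MP).
rewrite -/x -/y !ltr_norml -/q => /andP[y1 y2] /andP[x1 x2].
have dX : d * pr (basic_measure R b) (atom n) <= d * (x + q).
  by rewrite ler_wpM2l //; lra.
have cY : c * pr (basic_measure R b) (initial (fM l)) <= c * (y + q).
  by rewrite ler_wpM2l //; lra.
have cY' : c * (y - q) <= c * pr (basic_measure R b) (initial (fM l)).
  by rewrite ler_wpM2l //; lra.
by split=> //; [|split]; lra.
Qed.

Hypothesis Gc : computable 4 (fun w => nat_of_bool (G w)).
Hypothesis fMc : computable 1 (fun w => fM (nth 0%N w 0)).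
Hypothesis fcc : computable 1 (fun w => fc (nth 0%N w 0)).
Hypothesis fdc : computable 1 (fun w => fd (nth 0%N w 0)).

Lemma computable_admissible_ball k B P L I N : computable k B -> computable k P ->
  computable k L -> computable k I -> computable k N ->
  computable k (fun v => nat_of_bool (admissible_ball (B v) (P v) (L v) (I v) (N v))).
Proof.
move=> Bc Pc Lc Ic Nc; rewrite /admissible_ball /code_weight.
have c1 h : computable 1 (fun w => h (nth 0%N w 0)) -> computable k (fun v => h (L v)).
  move=> hc; apply: (computable_comp hc (G := fun v => [:: L v])).
  by computable_tac.
have Sc : computable k (fun v => \sum_(j < B v) nth_code (B v) j)%N.
  apply: (@computable_sum _ _ (fun v j => nth_code (B v) j)) => //.
  by computable_tac.
have Yc : computable k (fun v => \sum_(m < fM (L v)) nth_code (B v) m.+1)%N.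
  apply: (@computable_sum _ _ (fun v m => nth_code (B v) m.+1)); first exact: c1.
  by computable_tac.
move: (c1 _ fMc) (c1 _ fcc) (c1 _ fdc) => Mc Cc Dc.
by computable_tac.
Qed.

Lemma test_gt mu x r : ((ratr (ratnum r))%:E < test mu x)%E <->
  (nth_code r 0 < nth_code r 1)%N \/ exists2 l,
    (nth_code r 0 < nth_code r 1 + 2 ^ l * (nth_code r 2).+1)%N & admissible_set mu l x.
Proof.
split.
  move=> /ereal_sup_gt[y [->|[l -> lx]]]; rewrite lte_fin => ry.
    by left; rewrite -[0]/(0%:R) ratr_ratnum_lt mul0n addn0 in ry.
  by right; exists l => //; rewrite ratr_ratnum_lt in ry.
case=> [rlt|[l rlt lx]].
  apply: (@lt_le_trans _ _ 0%E); last by apply: ereal_sup_ubound; left.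
  by rewrite lte_fin -[0]/(0%:R) ratr_ratnum_lt mul0n addn0.
apply: (@lt_le_trans _ _ (2 ^ l)%:R%:E); last first.
  by apply: ereal_sup_ubound; right; exists l.
by rewrite lte_fin ratr_ratnum_lt.
Qed.

(** The stage S bounds all searches at once. The ball around the point numbered [n.+1] is so small
    that it contains only [n]. A negative [r] accepts every ball, as the test is nonnegative. *)
Definition test_enum (w : seq nat) : bool :=
  let S := nth 0%N w 0 in
  let b := nth 0%N w 1 in
  let p := nth 0%N w 2 in
  let j := nth 0%N w 3 in
  let q := nth 0%N w 4 in
  let r := nth 0%N w 5 in
  (nth_code r 0 < nth_code r 1)%N ||
  bex S (fun s => bex S (fun l => bex S (fun i => bex S (fun n => bex S (fun P =>
    [&& G [:: s; l; i; n], admissible_ball b P l i n, p == fraction_code 1 P.-1,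
        j == n.+1, q == fraction_code 1 (n.+1 * n.+2)
      & (nth_code r 0 < nth_code r 1 + 2 ^ l * (nth_code r 2).+1)%N]))))).

Lemma lower_semicomputable_test : lower_semicomputable test.
Proof.
exists [set v : 5.-tuple nat | exists s, test_enum (s :: v)].
  apply/rec_enumP; exists test_enum => //.
  rewrite /test_enum; computable_tac.
  by apply: computable_admissible_ball; computable_tac.
move=> mu x r; rewrite test_gt; split.
  case=> [rlt|[l rlt [n -> [s [i [Gi dn cM]]]]]].
    (* Balls of radius 3 contain every measure and every point, all distances being at most 1. *)
    exists 0%N, (fraction_code 3 0), 0%N, (fraction_code 3 0); split.
    - by exists 0%N; rewrite /test_enum /= rlt.
    - rewrite ratr_fraction_code divr1.
      apply: (@le_lt_trans _ _ 1); last by rewrite ltr1n.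
      apply: prokhorov_le => // A; rewrite (le_trans (pr_le1 _ _)) // lerDr.
      exact: pr_ge0.
    - rewrite ratr_fraction_code divr1 /Nbar_dist /= subr0.
      apply: (@le_lt_trans _ _ 1); last by rewrite ltr1n.
      case: x => [n|] /=; rewrite ?normr0 // ger0_norm // invf_le1 ?ltr0n //.
      by rewrite ler1n.
  have [b [P [bP mub]]] := admissible_ball_complete dn cM.
  have P0 : (0 < P)%N.
    by move/admissible_ballE: bP => [_ nP _ _ _]; exact: leq_trans nP.
  exists b, (fraction_code 1 P.-1), n.+1, (fraction_code 1 (n.+1 * n.+2)); split.
  - have [S [sS lS iS nS PS]] : exists S, [/\ s < S, l < S, i < S, n < S & P < S]%N.
      by exists (s + l + i + n + P).+1; split; lia.
    exists S; apply/orP; right.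
    apply/bexP; exists s => //; apply/bexP; exists l => //; apply/bexP; exists i => //.
    apply/bexP; exists n => //; apply/bexP; exists P => //=.
    by rewrite Gi bP !eqxx.
  - by rewrite ratr_fraction_code prednK // div1r.
  - by rewrite ratr_fraction_code /Nbar_dist subrr normr0 divr_gt0.
move=> [b [p [j [q [[S]]]]]]; rewrite /test_enum /= => /orP[rlt|]; first by left.
move=> /bexP[s _ /bexP[l _ /bexP[i _ /bexP[n _ /bexP[P _]]]]].
move=> /and5P[Gi bP /eqP-> /eqP-> /andP[/eqP-> rlt]].
have P0 : (0 < P)%N.
  by move/admissible_ballE: bP => [_ nP _ _ _]; exact: leq_trans nP.
rewrite !ratr_fraction_code prednK // !div1r => mub xn.
right; exists l => //; exists n.
  apply: (@Nbar_dist_isolated R n _ x _); last by rewrite Nbar_dist_sym; exact: xn.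
  by rewrite mulrC ler_pdivrMr ?ltr0n // mul1r ler_nat.
exists s, i; split=> //; by have [] := admissible_ball_sound bP mub.
Qed.

Hypothesis small : forall mu l, (2 * 4 ^ l)%:R * pr mu (admissible_set mu l) <= 1.

Lemma measurable_fun_Nbar d (T : sigmaRingType d) (f : Nbar -> T) :
  measurable_fun setT f.
Proof. by move=> mD Y mY; exact: measurable_Nbar. Qed.

(** The supremum is at most the sum over [l] of 2^l times the indicator of the level-l set. By
    [small], the l-th term has integral at most 2^-(l+1), and these bounds add up to 1. *)
Lemma integral_test (mu : probability Nbar R) : (\int[mu]_x test mu x <= 1)%E.
Proof.
pose f l (x : Nbar) : \bar R := ((2 ^ l)%:R * \1_(admissible_set mu l) x)%:E.
have f0 l x : (0 <= f l x)%E by rewrite lee_fin mulr_ge0.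
have test_le x : (test mu x <= \sum_(0 <= l <oo) f l x)%E.
  apply: ge_ereal_sup => y [->|[l -> lx]]; first exact: nneseries_ge0.
  apply: (@le_trans _ _ (\sum_(0 <= k < l.+1) f k x)%E); last first.
    exact: nneseries_lim_ge.
  rewrite big_nat_recr //= /f indicE mem_set // mulr1 leeDr // sume_ge0 //.
have test0 x : (0 <= test mu x)%E by apply: ereal_sup_ubound; left.
apply: (@le_trans _ _ (\int[mu]_x \sum_(0 <= l <oo) f l x)%E).
  apply: ge0_le_integral => //; exact: measurable_fun_Nbar.
rewrite integral_nneseries //; last by move=> l mD Y mY; exact: measurable_Nbar.
apply: le_trans (epsilon_trick0 xpredT ler01).
apply: lee_nneseries => [l _ _|l _]; first exact: integral_ge0.
rewrite (_ : (\int[mu]_x f l x)%E = ((2 ^ l)%:R * pr mu (admissible_set mu l))%:E).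
  rewrite lee_fin ler_pdivlMr ?ltr0n ?expn_gt0 //; apply: le_trans (small mu l).
  by rewrite mulrAC -natrM -expnD addnS addnn -mul2n expnS expnM.
under eq_integral do rewrite /f EFinM.
rewrite ge0_integralZl_EFin //.
by rewrite integral_indic // setIT EFinM -prE.
Qed.

Lemma randomness_test_test : randomness_test test.
Proof.
split; [|exact: lower_semicomputable_test|exact: integral_test].
by move=> mu x; apply: ereal_sup_ubound; left.
Qed.

(** Universality and neutrality give c 2^l <= 1 at a number admissible at level [l], hence l <= 2^l
    <= 1 / c. *)
Lemma neutral_admissible_bounded t nu : universal_test t -> neutral t nu ->
  exists L, forall l n, admissible nu l n -> (l <= L)%N.
Proof.
move=> [_ /(_ _ randomness_test_test)[c c0 ct]] t1.
exists (Num.trunc c^-1) => l n ln.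
have : (c%:E * (2 ^ l)%:R%:E <= 1)%E.
  apply: le_trans _ (t1 (Some n)); apply: le_trans _ (ct nu (Some n)).
  apply: lee_wpmul2l; first by rewrite lee_fin ltW.
  by apply: ereal_sup_ubound; right; exists l => //; exists n.
rewrite -EFinM lee_fin mulrC -ler_pdivlMr // mul1r => cl.
rewrite truncn_ge_nat ?invr_ge0 ?(ltW c0) //; apply: le_trans _ cl.
by rewrite ler_nat ltnW // ltn_expl.
Qed.
End test.

(** * Sets of light atoms *)

Section atoms.
Context {R : realType}.
Implicit Types mu : probability Nbar R.

Lemma pr_list_le mu (A : set Nbar) d (s : seq nat) :
  (forall x, A x -> exists n, [/\ x = Some n, n \in s & d%:R * pr mu (atom n) < 1]) ->
  d%:R * pr mu A <= (size s)%:R.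
Proof.
elim: s A => [|m s IH] A AP.
  rewrite (_ : A = set0) ?pr0 ?mulr0 //.
  by apply/seteqP; split=> // x /AP[n []].
have le_m : d%:R * pr mu (A `&` atom m) <= 1.
  have [Am|nAm] := pselect (A (Some m)).
    have [_ [[<-] _ /ltW]] := AP _ Am; apply: le_trans.
    by rewrite ler_wpM2l // pr_le // => x [].
  rewrite (_ : _ `&` _ = set0) ?pr0 ?mulr0 //.
  by apply/seteqP; split=> // x [+ xm]; rewrite xm.
have le_s : d%:R * pr mu (A `\` atom m) <= (size s)%:R.
  apply: IH => x [/AP[n [-> + dn]] nm]; rewrite inE => /predU1P[nm'|ns].
    by case: nm; rewrite /atom /= nm'.
  by exists n.
rewrite /= -natr1 addrC; apply: le_trans (lerD le_m le_s); rewrite -mulrDr.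
rewrite ler_wpM2l //; apply: le_trans (prU_le _ _ _); apply: pr_le => x Ax.
by have [] := pselect (atom m x); [left|right].
Qed.

(** Otherwise, for positive [d], the first d + 1 atoms would have mass at least 1 / d each, more
    than 1 in total. *)
Lemma exists_small_atom mu d : exists n, d%:R * pr mu (atom n) < 1.
Proof.
apply: contrapT => /forallNP large.
have := pr_le1 mu (initial d.+1); rewrite leNgt => /negP; apply.
case: d large => [/(_ 0%N)|d large]; first by rewrite mul0r ltr01.
rewrite pr_initial; apply: (@lt_le_trans _ _ (\sum_(n < d.+2) d.+1%:R^-1)).
  by rewrite sumr_const card_ord -[ltRHS]mulr_natl ltr_pdivlMr ?ltr0n // mul1r ltr_nat.
apply: ler_sum => n _; rewrite -[leLHS]mul1r ler_pdivrMr ?ltr0n // mulrC leNgt.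
exact/negP/large.
Qed.

End atoms.

(** * Upper semicomputable measures *)

Section upper.
Context {R : realType}.
Variables (t : probability Nbar R -> Nbar -> \bar R) (nu : probability Nbar R).
Hypotheses (ut : universal_test t) (nt : neutral t nu).

Lemma neutral_not_upper_semicomputable : ~ upper_semicomputable_over_nat nu.
Proof.
move=> /rec_enumP[P Pc PE].
have {}PE n r : pr nu (atom n) < ratr (ratnum r) <-> exists s, P [:: s; n; r].
  rewrite -(PE [tuple n; r]); split=> [ltr|[m [q [mq]]]].
    by exists n, r; split=> //; rewrite prE lte_fin.
  case: mq => <- <-; by rewrite prE lte_fin.
pose d l := (2 * 4 ^ l)%N.
have d0 l : (0 < d l)%N by rewrite muln_gt0 expn_gt0.
pose seen l s n := bex s (fun u => P [:: u; n; fraction_code 1 (d l).-1]).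
have seen_small l s n : seen l s n -> (d l)%:R * pr nu (atom n) < 1.
  move=> /bexP[u _ Pu]; have /PE : exists u, P [:: u; n; fraction_code 1 (d l).-1].
    by exists u.
  by rewrite ratr_fraction_code prednK // ltr_pdivlMr ?ltr0n // mulrC.
(* At each level, the first stage that has seen a light number below it, and the least number seen
   there: a single selection, whatever the measure. *)
pose G w := let l := nth 0%N w 1 in let s := nth 0%N w 0 in
  least (fun s => bex s (seen l s)) s && least (seen l s) (nth 0%N w 3).
have Gc : computable 4 (fun w => nat_of_bool (G w)).
  by rewrite /G /seen /d; computable_tac.
have small (mu : probability Nbar R) l :
    (2 * 4 ^ l)%:R * pr mu (admissible_set G (fun=> 0%N) (fun=> 0%N) d mu l) <= 1.
  have Gf (i m n : nat) : (exists s i, G [:: s; l; i; m]) ->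
      (exists s i, G [:: s; l; i; n]) -> m = n.
    move=> [s [i1 /andP[sl ml]]] [s' [i2 /andP[sl' nl]]].
    by rewrite (least_inj sl sl') in ml; exact: least_inj ml nl.
  have [s s1 sP] := functional_image 1 Gf.
  apply: le_trans (pr_list_le (s := s) _) _; last by rewrite (ler_nat R _ 1).
  move=> x [n -> [u [i [Gu dn _]]]]; exists n; split=> //.
  by apply: (sP 0%N) => //; exists u, i.
have dc : computable 1 (fun w => d (nth 0%N w 0)) by rewrite /d; computable_tac.
have zc := computable_cst 1 0.
have [L LP] := neutral_admissible_bounded Gc zc zc dc small ut nt.
have [n dn] := exists_small_atom nu (d L.+1).
have [u Pu] : exists u, P [:: u; n; fraction_code 1 (d L.+1).-1].
  by apply/PE; rewrite ratr_fraction_code prednK // ltr_pdivlMr ?ltr0n // mulrC.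
(* The stage has to exceed both the number [n] and the enumeration step [u] that certifies it. *)
have : bex (maxn u n).+1 (seen L.+1 (maxn u n).+1).
  apply/bexP; exists n; first by rewrite ltnS leq_maxr.
  by apply/bexP; exists u; first by rewrite ltnS leq_maxl.
move=> /(@least_exists (fun s => bex s (seen L.+1 s)))[s _ sl].
have /andP[/bexP[m _ /least_exists[k _ kl]] _] := sl.
have : admissible G (fun=> 0%N) (fun=> 0%N) d nu L.+1 k.
  exists s, 0%N; split; first by rewrite /G /= sl.
    by move: kl => /andP[/seen_small].
  by rewrite mul0r add0r ltr01 ltr1n.
by move=> /LP; rewrite ltnn.
Qed.

End upper.

(** * Lower semicomputable measures *)

Section lower.
Context {R : realType}.
Variables (t : probability Nbar R -> Nbar -> \bar R) (nu : probability Nbar R).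
Hypotheses (ut : universal_test t) (nt : neutral t nu).
Variable P : seq nat -> bool.
Hypothesis Pc : computable 3 (fun w => nat_of_bool (P w)).
Hypothesis PE : forall n r,
  ratr (ratnum r) < pr nu (atom n) <-> exists s, P [:: s; n; r].

(* [stage s x D / D] approximates the mass of [x] from below, and
   [stage_sum s M D / D] approximates the mass of [0, M). *)
Definition stage s x D :=
  (\sum_(a < D) bex s (fun u => P [:: u; x; fraction_code a.+1 D.-1]))%N.

Definition stage_sum s M D := (\sum_(x < M) stage s x D)%N.

Lemma fraction_lt x a D : (0 < D)%N ->
  ((a%:R : R) < D%:R * pr nu (atom x)) = (ratr (ratnum (fraction_code a D.-1)) < pr nu (atom x)).
Proof.
by move=> D0; rewrite ratr_fraction_code prednK // ltr_pdivrMr ?ltr0n // mulrC.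
Qed.

Lemma bex_widen s s' (Q : nat -> bool) : (s <= s')%N -> (bex s Q <= bex s' Q)%N.
Proof.
move=> ss'; case: bexP => //= -[i i_lt Qi]; rewrite lt0b.
by apply/bexP; exists i => //; exact: leq_trans ss'.
Qed.

Lemma stage_mono s s' x D : (s <= s')%N -> (stage s x D <= stage s' x D)%N.
Proof. by move=> ss'; apply: leq_sum => a _; exact: bex_widen. Qed.

Lemma stage_le s x D : (0 < D)%N -> (stage s x D)%:R <= D%:R * pr nu (atom x).
Proof.
move=> D0; have Dx0 : 0 <= D%:R * pr nu (atom x) by rewrite mulr_ge0 ?pr_ge0.
apply: (@le_trans _ _ (Num.trunc (D%:R * pr nu (atom x)))%:R); last first.
  by rewrite truncn_le.
rewrite ler_nat (leq_trans _ (geq_minr D _)) // -sum_ltn; apply: leq_sum => a _.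
case: bexP => //= -[u _ Pu]; rewrite lt0b truncn_gt_nat ltW //.
by rewrite fraction_lt //; apply/PE; exists u.
Qed.

(** Only thresholds (a + 1) / D strictly below the mass get certified: one unit is lost to this
    strictness and another to truncation. *)
Lemma stage_complete x D : (0 < D)%N ->
  exists s, D%:R * pr nu (atom x) <= (stage s x D)%:R + 2.
Proof.
move=> D0; have Dx0 : 0 <= D%:R * pr nu (atom x) by rewrite mulr_ge0 ?pr_ge0.
have /choice[u uP] : forall a : nat, exists u, a.+1%:R < D%:R * pr nu (atom x) ->
    P [:: u; x; fraction_code a.+1 D.-1].
  move=> a; have [a_lt|a_ge] := boolP (a.+1%:R < D%:R * pr nu (atom x)).
    by have /PE[u Pu] : ratr (ratnum (fraction_code a.+1 D.-1)) < pr nu (atom x);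
      [rewrite -fraction_lt|exists u].
  by exists 0%N.
exists (\max_(a < D) u a).+1.
set T := Num.trunc (D%:R * pr nu (atom x)).
have TD : (T <= D)%N.
  rewrite -(ler_nat R); apply: (@le_trans _ _ (D%:R * pr nu (atom x))).
    by rewrite truncn_le.
  by rewrite ler_piMr // pr_le1.
suff : (T.-1 <= stage (\max_(a < D) u a).+1 x D)%N.
  rewrite -(ler_nat R); have := truncnS_gt (D%:R * pr nu (atom x)); rewrite -/T.
  case: T {TD} => [|T] /=; first by lra.
  by rewrite -!natr1; lra.
rewrite -[leqLHS](minn_idPr _ : minn D T.-1 = _); last exact: leq_trans (leq_pred _) TD.
rewrite -sum_ltn; apply: leq_sum => a _; case: ltnP => // aT.
rewrite lt0b; apply/bexP; exists (u a); first by rewrite ltnS (leq_bigmax a).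
apply: uP; apply: (@lt_le_trans _ _ T%:R); last by rewrite truncn_le.
by rewrite ltr_nat; lia.
Qed.

Lemma stage_sum_le s M D : (0 < D)%N ->
  (stage_sum s M D)%:R <= D%:R * pr nu (initial M).
Proof.
by move=> D0; rewrite pr_initial mulr_sumr natr_sum ler_sum // => x _; exact: stage_le.
Qed.

Lemma stage_sum_mono s s' M M' D : (s <= s')%N -> (M <= M')%N ->
  (stage_sum s M D <= stage_sum s' M' D)%N.
Proof.
move=> ss' MM'; rewrite /stage_sum -(subnKC MM') big_split_ord /=.
by rewrite (leq_trans _ (leq_addr _ _)) // leq_sum // => x _; exact: stage_mono.
Qed.

Lemma stage_sum_complete M D : (0 < D)%N ->
  exists s, D%:R * pr nu (initial M) <= (stage_sum s M D + 2 * M)%:R.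
Proof.
move=> D0; have /choice[u uP] := fun x => stage_complete x D0.
exists (\max_(x < M) u x)%N.
have E2 : (2 * M)%:R = \sum_(x < M) 2 :> R by rewrite sumr_const card_ord natrM mulr_natr.
rewrite pr_initial mulr_sumr natrD natr_sum E2 -big_split /= ler_sum // => x _.
apply: (le_trans (uP x)).
by rewrite lerD2r ler_nat stage_mono // leq_bigmax.
Qed.

(** All masses are approximated from below, so the error at one number is at most the total error on
    [0, M). *)
Lemma stage_error s x M D : (0 < D)%N -> (x < M)%N ->
  D%:R * pr nu (atom x) - (stage s x D)%:R <=
  D%:R * pr nu (initial M) - (stage_sum s M D)%:R.
Proof.
move=> D0 xM; rewrite pr_initial mulr_sumr [in leRHS]natr_sum -sumrB.
rewrite (bigD1 (Ordinal xM)) //= lerDl sumr_ge0 // => y _.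
by rewrite subr_ge0 stage_le.
Qed.

(* Stage [s] certifies that the total mass of the natural numbers exceeds [i / g]. *)
Definition crossed g i s :=
  bex s (fun D => i * D.+1 < stage_sum s s D.+1 * g)%N.

Lemma crossed_lt g i s : crossed g i s -> i%:R < g%:R * pr nu (initial s).
Proof.
move=> /bexP[D _]; rewrite -(ltr_nat R) !natrM => lt_i.
rewrite -(ltr_pM2r (ltr0n R D.+1)); apply: (lt_le_trans lt_i).
by rewrite [leLHS]mulrC -[leRHS]mulrA ler_wpM2l // [leRHS]mulrC stage_sum_le.
Qed.

Lemma crossed_exists g i M : i%:R < g%:R * pr nu (initial M) ->
  exists s, crossed g i s.
Proof.
move=> lt_i; set e := g%:R * pr nu (initial M) - i%:R.
have e0 : 0 < e by rewrite subr_gt0.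
pose D := Num.trunc ((2 * M * g)%:R / e).
have De : (2 * M * g)%:R < D.+1%:R * e.
  by rewrite -ltr_pdivrMr // truncnS_gt.
have [s0 s0P] := stage_sum_complete M (ltn0Sn D).
(* In [crossed] a single number bounds the stage, the range of the sum and the denominator. *)
pose s := maxn s0 (maxn M D.+1).
exists s; apply/bexP; exists D; first by rewrite /s !leq_max leqnn !orbT.
apply: (@leq_trans (stage_sum s0 M D.+1 * g)); last first.
  by rewrite leq_mul2r stage_sum_mono ?orbT // /s !leq_max leqnn ?orbT.
rewrite -(ltr_nat R) natrM natrM.
have : D.+1%:R * (g%:R * pr nu (initial M)) <= (stage_sum s0 M D.+1)%:R * g%:R + (2 * M * g)%:R.
  by rewrite mulrCA mulrC natrM -mulrDl -natrD ler_wpM2r.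
by move: De; rewrite /e mulrBr; lra.
Qed.

(* At level [l], a number is light when its mass is below [1 / lvl_d l]; the total
   mass crosses at most [lvl_g l] points of the grid of step [1 / lvl_g l], so the
   numbers selected at the crossings must have mass below [1 / lvl_w l].  Masses on
   [0, lvl_M l) are measured up to [1 / lvl_c l], and approximated from below by
   multiples of [1 / (lvl_c l * lvl_M l)]. *)
Definition lvl_d l := (4 * 4 ^ l)%N.
Definition lvl_g l := (2 * lvl_d l)%N.
Definition lvl_w l := (2 * 4 ^ l * lvl_g l)%N.
Definition lvl_M l := (2 * lvl_w l)%N.
Definition lvl_c l := (8 * lvl_w l)%N.

Let levels_gt0 l : [/\ (0 < lvl_d l)%N, (0 < lvl_g l)%N, (0 < lvl_w l)%N,
  (0 < lvl_M l)%N & (0 < lvl_c l)%N].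
Proof. by split; rewrite /lvl_c /lvl_M /lvl_w /lvl_g /lvl_d !muln_gt0 !expn_gt0. Qed.

Definition light l s x :=
  (stage s x (lvl_c l * lvl_M l) * lvl_M l <= lvl_c l * lvl_M l)%N.

(** Pigeonhole: if all [lvl_M l] numbers had approximate mass above 1 / [lvl_M l], the total would
    exceed 1. *)
Lemma light_exists l s : exists2 x, (x < lvl_M l)%N & light l s x.
Proof.
have [_ _ _ M0 c0] := levels_gt0 l.
apply: contrapT => nlight; set D := (lvl_c l * lvl_M l)%N.
have D0 : (0 < D)%N by rewrite muln_gt0 c0.
have : (stage_sum s (lvl_M l) D <= D)%N.
  by rewrite -(ler_nat R) (le_trans (stage_sum_le _ _ D0)) // ler_piMr // pr_le1.
apply/negP; rewrite -ltnNge -(ltn_pmul2r M0) /stage_sum big_distrl /=.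
apply: (@leq_trans (\sum_(x < lvl_M l) D.+1)); last first.
  apply: leq_sum => x _; rewrite ltnNge; apply/negP => xl.
  by apply: nlight; exists x.
by rewrite sum_nat_const card_ord mulnC ltn_pmul2l.
Qed.

(** In units of 1 / [lvl_c l], the approximate mass of [0, [lvl_M l]) exceeds i - 3. Two units are
    the error left by [stage_sum_complete]; the third makes the inequality strict. *)
Definition settled l i s :=
  (i * lvl_M l < stage_sum s (lvl_M l) (lvl_c l * lvl_M l) + 3 * lvl_M l)%N.

Definition late_light w :=
  let s := nth 0%N w 0 in let l := nth 0%N w 1 in
  bex (lvl_g l) (fun i => least (crossed (lvl_g l) i) s) &&
  least (light l s) (nth 0%N w 3).

Definition settling w :=
  let s := nth 0%N w 0 in let l := nth 0%N w 1 in
  (nth 0%N w 3 == s) && least (settled l (nth 0%N w 2)) s.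

Lemma computable_stage k S X D : computable k S -> computable k X -> computable k D ->
  computable k (fun v => stage (S v) (X v) (D v)).
Proof.
move=> Sc Xc Dc; apply: (@computable_sum _ _
  (fun v a => bex (S v) (fun u => P [:: u; X v; fraction_code a.+1 (D v).-1]))) => //.
by computable_tac.
Qed.

Lemma computable_stage_sum k S M D : computable k S -> computable k M -> computable k D ->
  computable k (fun v => stage_sum (S v) (M v) (D v)).
Proof.
move=> Sc Mc Dc; apply: (@computable_sum _ _ (fun v x => stage (S v) x (D v))) => //.
by apply: computable_stage; computable_tac.
Qed.

Lemma computable_late_light : computable 4 (fun w => nat_of_bool (late_light w)).
Proof.
rewrite /late_light /crossed /light /lvl_M /lvl_c /lvl_w /lvl_g /lvl_d; computable_tac.
- by apply: computable_stage_sum; computable_tac.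
- by apply: computable_stage; computable_tac.
Qed.

Lemma computable_settling : computable 4 (fun w => nat_of_bool (settling w)).
Proof.
rewrite /settling /settled /lvl_M /lvl_c /lvl_w /lvl_g /lvl_d; computable_tac.
by apply: computable_stage_sum; computable_tac.
Qed.

(** At most [lvl_g l] numbers are selected, one for each grid point; the factor [lvl_g l] in
    [lvl_w l] absorbs this count. *)
Lemma late_light_small (mu : probability Nbar R) l :
  (2 * 4 ^ l)%:R * pr mu (admissible_set late_light (fun=> 0%N) (fun=> 0%N) lvl_w mu l) <= 1.
Proof.
have [_ g0 _ _ _] := levels_gt0 l.
have Qf (i m n : nat) :
    (exists2 s, least (crossed (lvl_g l) i) s & least (light l s) m) ->
    (exists2 s, least (crossed (lvl_g l) i) s & least (light l s) n) -> m = n.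
  move=> [s si ms] [s' s'i ns'].
  by rewrite (least_inj si s'i) in ms; exact: least_inj ms ns'.
have [s sg sP] := functional_image (lvl_g l) Qf.
have : (lvl_w l)%:R * pr mu (admissible_set late_light (fun=> 0%N) (fun=> 0%N) lvl_w mu l)
    <= (lvl_g l)%:R.
  apply: le_trans (pr_list_le (s := s) _) _; last by rewrite ler_nat.
  move=> x [n -> [u [j [/andP[/bexP[i ig ui] un] dn _]]]]; exists n; split=> //.
  by apply: (sP i) => //; exists u.
rewrite /lvl_w natrM mulrAC -[X in _ <= X -> _]mul1r ler_pM2r //.
by rewrite ltr0n.
Qed.

(** The guess [i] can only be the integer part of z or its successor. At most two numbers are
    selected, and [lvl_d l] is twice 2 * 4^l. *)
Lemma settling_small (mu : probability Nbar R) l :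
  (2 * 4 ^ l)%:R * pr mu (admissible_set settling lvl_M lvl_c lvl_d mu l) <= 1.
Proof.
set z := (lvl_c l)%:R * pr mu (initial (lvl_M l)).
have z0 : 0 <= z by rewrite mulr_ge0 ?pr_ge0.
have Qf (j m n : nat) :
    least (settled l (Num.trunc z + j)) m -> least (settled l (Num.trunc z + j)) n -> m = n.
  exact: least_inj.
have [s s2 sP] := functional_image 2 Qf.
have : (lvl_d l)%:R * pr mu (admissible_set settling lvl_M lvl_c lvl_d mu l) <= 2%:R.
  apply: le_trans (pr_list_le (s := s) _) _; last by rewrite ler_nat.
  move=> x [n -> [u [i [/andP[/eqP /= <- ui] dn /andP[iz zi]]]]]; exists n; split=> //.
  have le_i : (Num.trunc z <= i)%N.
    by rewrite truncn_le_nat -(ltrD2r 1) natr1.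
  have i_le : (i <= (Num.trunc z).+1)%N.
    rewrite -ltnS -(ltr_nat R) (lt_trans iz) // -[in ltRHS]natr1 ltrD2r.
    exact: truncnS_gt.
  apply: (sP (i - Num.trunc z)%N); first by lia.
  by rewrite subnKC.
rewrite (_ : lvl_d l = 2 * (2 * 4 ^ l))%N; last by rewrite /lvl_d mulnA.
by rewrite natrM -mulrA -[X in _ <= X -> _]mulr1 ler_pM2l.
Qed.

(* If [atom s] is heavy, a grid point [i / g] is crossed after stage [s], when the
   approximations on [0, M) are already accurate: what looks light then is light. *)
Lemma heavy_light l i s : least (settled l i) s ->
  (lvl_c l)%:R * pr nu (initial (lvl_M l)) + 1 < i.+2%:R ->
  1 <= (lvl_d l)%:R * pr nu (atom s) ->
  exists x, admissible late_light (fun=> 0%N) (fun=> 0%N) lvl_w nu l x.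
Proof.
have [d0 g0 w0 M0 c0] := levels_gt0 l.
move=> /andP[ss _] zi ds; set g := lvl_g l.
(* The first grid point above the mass of [0, s). The atom [s] has mass at least 1 / [lvl_d l],
   which is 2 / g, so adding it carries the mass past k / g. *)
pose k := (Num.trunc (g%:R * pr nu (initial s))).+1.
have gz0 : 0 <= g%:R * pr nu (initial s) by rewrite mulr_ge0 ?pr_ge0.
have gk : g%:R * pr nu (initial s) < k%:R by exact: truncnS_gt.
have kg : k%:R < g%:R * pr nu (initial s.+1).
  rewrite pr_initial big_ord_recr /= -pr_initial mulrDr /k -natr1.
  rewrite ler_ltD ?truncn_le //.
  by rewrite /g /lvl_g natrM -mulrA; lra.
have k_lt : (k < g)%N.
  rewrite -(ltr_nat R); apply: (lt_le_trans kg); rewrite ler_piMr //.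
  exact: pr_le1.
have [u0 /least_exists[u _ uk]] := crossed_exists kg.
(* A crossing certified at a stage u < s would give [0, u), and hence [0, s), a mass above k / g. *)
have su : (s <= u)%N.
  rewrite leqNgt; apply/negP => us.
  have /andP[/crossed_lt ku _] := uk; have := lt_trans gk ku.
  rewrite ltr_pM2l ?ltr0n // ltNge => /negP; apply.
  by apply: pr_le => -[m|] //=; move=> /leq_trans; apply; exact: ltnW.
have [x0 x0M /least_exists[x x_le ux]] := light_exists l u.
have xM : (x < lvl_M l)%N by exact: leq_ltn_trans x0M.
exists x, u, 0%N; split; last by rewrite mul0r add0r ltr01 ltr1n.
  by apply/andP; split=> //; apply/bexP; exists k.
have /andP[lx _] := ux; move: lx; rewrite /light leq_pmul2r // => lx.
have D0 : (0 < lvl_c l * lvl_M l)%N by rewrite muln_gt0 c0.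
have err := stage_error u D0 xM.
have mono : (stage_sum s (lvl_M l) (lvl_c l * lvl_M l) <=
             stage_sum u (lvl_M l) (lvl_c l * lvl_M l))%N by exact: stage_sum_mono.
set D := (lvl_c l * lvl_M l)%N in ss lx D0 err mono.
have {}ss : i%:R * (lvl_M l)%:R < (stage_sum s (lvl_M l) D)%:R + 3 * (lvl_M l)%:R :> R.
  by rewrite -!natrM -natrD ltr_nat.
have {}mono : (stage_sum s (lvl_M l) D)%:R <= (stage_sum u (lvl_M l) D)%:R :> R.
  by rewrite ler_nat.
have {}lx : (stage u x D)%:R <= (lvl_c l)%:R :> R by rewrite ler_nat.
have {}zi : D%:R * pr nu (initial (lvl_M l)) < (i%:R + 1) * (lvl_M l)%:R.
  rewrite natrM mulrAC ltr_pM2r ?ltr0n //.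
  by move: zi; rewrite -addn2 natrD; lra.
(* In units of 1 / D, lightness bounds the approximate mass of x by [lvl_c l]. The error is below 4
   [lvl_M l]: 3 from [settled] and 1 from the guess [i]. The sum is 16 [lvl_w l], while D is 16
   times the square of [lvl_w l]. *)
have : D%:R * pr nu (atom x) < (16 * lvl_w l)%:R.
  have -> : (16 * lvl_w l)%:R = (lvl_c l)%:R + 4 * (lvl_M l)%:R :> R.
    by rewrite /lvl_c /lvl_M !natrM; lra.
  by move: err ss mono lx zi; lra.
rewrite (_ : D = 16 * lvl_w l * lvl_w l)%N; last by rewrite /D /lvl_c /lvl_M; lia.
rewrite natrM -mulrA -[X in _ < X -> _]mulr1 ltr_pM2l // ltr0n muln_gt0 //.
Qed.

Lemma neutral_not_lower_approximable : False.
Proof.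
have zc := computable_cst 1 0.
have wc : computable 1 (fun w => lvl_w (nth 0%N w 0)).
  by rewrite /lvl_w /lvl_g /lvl_d; computable_tac.
have Mc : computable 1 (fun w => lvl_M (nth 0%N w 0)).
  by rewrite /lvl_M /lvl_w /lvl_g /lvl_d; computable_tac.
have cc : computable 1 (fun w => lvl_c (nth 0%N w 0)).
  by rewrite /lvl_c /lvl_w /lvl_g /lvl_d; computable_tac.
have dc : computable 1 (fun w => lvl_d (nth 0%N w 0)).
  by rewrite /lvl_d; computable_tac.
have [L1 L1P] := neutral_admissible_bounded computable_late_light zc zc wc late_light_small ut nt.
have [L2 L2P] := neutral_admissible_bounded computable_settling Mc cc dc settling_small ut nt.
(* At this level neither test may select a number that is light for [nu]. *)
pose l := (maxn L1 L2).+1.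
have [_ _ _ M0 c0] := levels_gt0 l.
set z := (lvl_c l)%:R * pr nu (initial (lvl_M l)).
have z0 : 0 <= z by rewrite mulr_ge0 ?pr_ge0.
have /andP[iz zi] := truncn_itv z0; set i := Num.trunc z in iz zi.
have [s0 s0P] : exists s, settled l i s.
  have D0 : (0 < lvl_c l * lvl_M l)%N by rewrite muln_gt0 c0.
  have [s sP] := stage_sum_complete (lvl_M l) D0.
  exists s; rewrite /settled -(ltr_nat R) natrM.
  apply: (@le_lt_trans _ _ (z * (lvl_M l)%:R)); first by rewrite ler_wpM2r.
  rewrite /z mulrAC -natrM; apply: (le_lt_trans sP).
  by rewrite ltr_nat ltn_add2l ltn_pmul2r.
have [s _ sl] := least_exists s0P.
have zi2 : z + 1 < i.+2%:R by rewrite -natr1 ltrD2r.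
(* If the atom at the first settled stage is light, the test from [settling] forbids it; if it is
   heavy, [heavy_light] yields a number forbidden by the test from [late_light]. *)
have [ds|ds] := ltrP ((lvl_d l)%:R * pr nu (atom s)) 1.
  have : admissible settling lvl_M lvl_c lvl_d nu l s.
    exists s, i; split=> //; first by rewrite /settling /= eqxx.
    by rewrite zi2 andbT (le_lt_trans iz) // ltrDl.
  by move=> /L2P; rewrite leqNgt ltnS leq_maxr.
have [x /L1P] := heavy_light sl zi2 ds.
by rewrite leqNgt ltnS leq_maxl.
Qed.

End lower.

Theorem theorem5p6 (R : realType) (t : probability Nbar R -> Nbar -> \bar R)
    (ht : universal_test t) :
  ~ exists nu : probability Nbar R,
      neutral t nu /\
      (upper_semicomputable_over_nat nu \/ lower_semicomputable_over_nat nu).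
Proof.
move=> [nu [nt [|/rec_enumP[P Pc PE]]]].
  exact: neutral_not_upper_semicomputable ht nt.
apply: (@neutral_not_lower_approximable R t nu ht nt P Pc) => n r.
rewrite -(PE [tuple n; r]); split=> [ltr|[m [q [mq]]]].
  by exists n, r; split=> //; rewrite prE lte_fin.
by case: mq => <- <-; rewrite prE lte_fin.
Qed.
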